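(* Let $r\ge s$ be positive integers, and let $T=T_{r,s}$ and $R=R_{r,s}$ be the trapezoid and rectangle posets. Then the map $\zeta=\zeta_1\circ\cdots\circ\zeta_{s-1}\colon\mathbb R_+^T\to\mathbb R_+^R$ is equivariant with respect to birational (antichain) rowmotion: $$\zeta\circ\tilde\rho_T=\tilde\rho_R\circ\zeta.$$ In particular, birational rowmotion on the trapezoid (either $\tilde\rho_T$ or $\rho_T$) has order $r+s$.
   Context: All posets are finite, $\mathbb R_+$ denotes the positive reals, $\lessdot$ denotes cover relations, and $[n]=\{1,\dots,n\}$. Posets (all with the componentwise order): $R_{r,s}=[r]\times[s]$; the right trapezoid $RT_{r,s}=\{(i,j)\in[r+s-1]\times[s] : i-j<r\}$; the trapezoid $T_{r,s}=\{(i,j)\in RT_{r,s}: i+j>s\}$. For $1\le k\le s$ the intermediate poset $I_k$ is the induced subposet of $RT_{r,s}$ on $T_{r,k}\cup[(k,k+1),(r+k-1,s)]$ (the second set is an interval of $RT_{r,s}$, empty when $k=s$). One has $I_1=R_{r,s}$ and $I_s=T_{r,s}$. Rowmotion: for a poset $P$, let $\widehat P$ be $P$ with a new minimum $\hat0$ and a new maximum $\hat1$ adjoined; labelings $x\in\mathbb R_+^P$ are extended by $x_{\hat0}=x_{\hat1}=1$. For $p\in P$, the toggle $t_p\colon\mathbb R_+^P\to\mathbb R_+^P$ replaces $x_p$ by $\left(\sum_{q\gtrdot p}\frac1{x_q}\right)^{-1}\left(\sum_{q\lessdot p}x_q\right)\frac1{x_p}$ (covers taken in $\widehat P$) and fixes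 all other coordinates. Rowmotion is $\rho_P=t_{L^{-1}(1)}\circ t_{L^{-1}(2)}\circ\cdots\circ t_{L^{-1}(n)}$ for any linear extension $L\colon P\to[n]$. Antichain rowmotion: the toggle $\tau_p\colon\mathbb R_+^P\to\mathbb R_+^P$ replaces $x_p$ by $\left(\sum_{C}\prod_{q\in C}x_q\right)^{-1}$, where $C$ ranges over all maximal chains of $P$ containing $p$, and fixes all other coordinates. Then $\tilde\rho_P=\tau_{L^{-1}(n)}\circ\cdots\circ\tau_{L^{-1}(1)}$ for any linear extension $L\colon P\to[n]$. Both $\rho_P$ and $\tilde\rho_P$ are bijections independent of $L$. The maps $\zeta_k\colon\mathbb R_+^{I_{k+1}}\to\mathbb R_+^{I_k}$ ($1\le k\le s-1$): let $M_k$ be the interval $[(k,1),(r+k,k+1)]$ of $RT_{r,s}$ and let $\tilde\rho_k$ be antichain rowmotion on $M_k$. For $x\in\mathbb R_+^{I_{k+1}}$ let $\bar x\in\mathbb R_+^{M_k}$ be obtained by restricting $x$ to $M_k\setminus\{(k,1)\}\subseteq I_{k+1}$ and setting $\bar x_{k,1}=1$ (any positive value gives the same map). Then $$\zeta_k(x)_{ij}=\begin{cases}\tilde\rho_k^{-1}(\bar x)_{ij}&\text{if }(i,j)\in I_k\cap M_k=M_k\setminus\{(r+k,k+1)\},\\ x_{i+1,j}&\text{if }(i,j)\in I_k\setminus M_k\text{ and }j>k+1,\\ x_{i,j+1}&\text{if }(i,j)\in I_k\setminus M_k\text{ and }i<k.\end{cases}$$ *)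

(* Defs.v *)
From HB Require Import structures.
From mathcomp Require Import all_boot all_order all_algebra.
From mathcomp Require Import boolp classical_sets functions reals.
From mathcomp Require Import interval_inference.
From mathcomp Require Import zify.

Set Implicit Arguments.
Unset Strict Implicit.
Unset Printing Implicit Defensive.

Import Order.TTheory GRing.Theory Num.Theory.
Local Open Scope ring_scope.

(* R_+^P *)
Definition labeling (R : realType) (P : finType) := {ffun P -> {posnum R}}.

Section Posets.
Variables (d : Order.disp_t) (P : finPOrderType d).

Definition covered_by (p q : P) : bool :=
  (p < q)%O && [forall c : P, ~~ ((p < c)%O && (c < q)%O)].

Definition chain (C : {set P}) : bool :=
  [forall p in C, forall q in C, (p >=< q)%O].

Definition maximal_chain (C : {set P}) : bool := maxset chain C.

(* A linear extension L : P -> [n] is represented by the sequence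
   L^-1(1), ..., L^-1(n). *)
Definition is_linear_extension (e : seq P) : bool :=
  [&& uniq e, [forall p : P, p \in e] &
      [forall p : P, forall q : P, (p < q)%O ==> (index p e < index q e)%N]].

Record linext := LinExt {
  linext_seq :> seq P;
  linextP : is_linear_extension linext_seq }.

Lemma ex_linext : inhabited linext.
Proof.
pose f (p : P) := #|[set c : P | (c < p)%O]|.
constructor; exists (sort (relpre f leq) (enum P)).
rewrite /is_linear_extension sort_uniq enum_uniq /=; apply/andP; split.
  by apply/forallP => p; rewrite mem_sort mem_enum.
apply/forallP => p; apply/forallP => q; apply/implyP => pq; rewrite ltnNge.
have fpq : (f p < f q)%N.
  apply: proper_card; apply/properP; split; last by exists p; rewrite !inE ?ltxx.
  by apply/fintype.subsetP => c; rewrite !inE => /lt_trans; apply.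
apply: contraL fpq => qp; rewrite -leqNgt.
apply: (@sorted_leq_index P (relpre f leq) _ _ (sort (relpre f leq) (enum P)));
  rewrite ?mem_sort ?mem_enum//.
- by move=> a b c; apply: leq_trans.
- by move=> a; apply: leqnn.
- by apply: sort_sorted => a b; apply: leq_total.
Qed.

Lemma ex_covered_by_up (a b : P) : (a < b)%O -> exists c, covered_by a c.
Proof.
move=> ab; case: (@arg_minnP _ b (fun c => a < c)%O
  (fun c => #|[set e : P | (e < c)%O]|) ab) => c ac cmin.
exists c; rewrite /covered_by ac; apply/forallP => e; apply/negP => /andP[ae ec].
have := cmin e ae; apply/negP; rewrite -ltnNge; apply: proper_card.
apply/properP; split; last by exists e; rewrite !inE ?ltxx.
by apply/fintype.subsetP => f; rewrite !inE => /lt_trans; apply.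
Qed.

Lemma ex_covered_by_down (a b : P) : (a < b)%O -> exists c, covered_by c b.
Proof.
move=> ab; case: (@arg_minnP _ a (fun c => c < b)%O
  (fun c => #|[set e : P | (c < e)%O]|) ab) => c cb cmin.
exists c; rewrite /covered_by cb; apply/forallP => e; apply/negP => /andP[ce eb].
have := cmin e eb; apply/negP; rewrite -ltnNge; apply: proper_card.
apply/properP; split; last by exists e; rewrite !inE ?ltxx.
by apply/fintype.subsetP => f; rewrite !inE; apply: lt_trans.
Qed.

Lemma ex_maximal_chain (p : P) : exists2 C, maximal_chain C & p \in C.
Proof.
have chp : chain [set p].
  by apply/forall_inP => x /set1P ->; apply/forall_inP => y /set1P ->;
     rewrite comparablexx.
have [C mC pC] := maxset_exists chp; exists C => //.
by rewrite (fintype.subsetP pC) ?set11.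
Qed.

End Posets.

(* P with a new minimum [hat_bot] and a new maximum [hat_top] adjoined. *)
Section Hat.
Variables (d : Order.disp_t) (P : finPOrderType d).

Definition hat : Type := option (option P).
HB.instance Definition _ := Finite.on hat.

Definition hat_bot : hat := None.
Definition hat_top : hat := Some None.
Definition hat_in (p : P) : hat := Some (Some p).

Definition hat_le (a b : hat) : bool :=
  match a, b with
  | None, _ => true
  | _, None => false
  | _, Some None => true
  | Some None, _ => false
  | Some (Some p), Some (Some q) => (p <= q)%O
  end.

Lemma hat_le_refl : reflexive hat_le.
Proof. by case=> [[p|]|] //=. Qed.

Lemma hat_le_anti : antisymmetric hat_le.
Proof. by case=> [[p|]|] [[q|]|] //= /le_anti ->. Qed.

Lemma hat_le_trans : transitive hat_le.
Proof. by case=> [[p|]|] [[q|]|] [[t|]|] //=; apply: le_trans. Qed.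

HB.instance Definition _ :=
  Order.Le_isPOrder.Build d hat hat_le_refl hat_le_anti hat_le_trans.

Lemma hat_bot_lt p : (hat_bot < hat_in p)%O.
Proof. by rewrite lt_neqAle. Qed.

Lemma hat_lt_top p : (hat_in p < hat_top)%O.
Proof. by rewrite lt_neqAle. Qed.

End Hat.

Section Rowmotion.
Variables (R : realType) (d : Order.disp_t) (P : finPOrderType d).
Implicit Types (x : labeling R P) (p q : P).

Definition hat_label x (a : hat P) : {posnum R} :=
  if a is Some (Some p) then x p else 1%:pos.

Definition toggle_value x p : R :=
  (\sum_(a : hat P | covered_by (hat_in p) a) ((hat_label x a)%:num)^-1)^-1
  * (\sum_(a : hat P | covered_by a (hat_in p)) (hat_label x a)%:num)
  * ((x p)%:num)^-1.

Lemma toggle_value_gt0 x p : 0 < toggle_value x p.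
Proof.
have [a ap] := ex_covered_by_up (hat_lt_top p).
have [b bp] := ex_covered_by_down (hat_bot_lt p).
rewrite /toggle_value !mulr_gt0 ?invr_gt0//.
- by rewrite (bigD1 a)//= ltr_pwDl// sumr_ge0.
- by rewrite (bigD1 b)//= ltr_pwDl// sumr_ge0.
Qed.

Definition toggle p x : labeling R P :=
  [ffun q => if q == p then PosNum (toggle_value_gt0 x p) else x q].

(* t_{L^-1(1)} o ... o t_{L^-1(n)} *)
Definition rowmotion (L : linext P) x : labeling R P := foldr toggle x L.

Definition antichain_toggle_value x p : R :=
  (\sum_(C : {set P} | maximal_chain C && (p \in C))
      \prod_(q in C) (x q)%:num)^-1.

Lemma antichain_toggle_value_gt0 x p : 0 < antichain_toggle_value x p.
Proof.
have [C mC pC] := ex_maximal_chain p.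
rewrite /antichain_toggle_value invr_gt0 (bigD1 C) ?mC//= ltr_pwDl ?prodr_gt0//.
by rewrite sumr_ge0// => D _; rewrite prodr_ge0.
Qed.

Definition antichain_toggle p x : labeling R P :=
  [ffun q => if q == p then PosNum (antichain_toggle_value_gt0 x p) else x q].

(* tau_{L^-1(n)} o ... o tau_{L^-1(1)} *)
Definition antichain_rowmotion (L : linext P) x : labeling R P :=
  foldl (fun y p => antichain_toggle p y) x L.

Lemma antichain_toggleK p : involutive (antichain_toggle p).
Proof.
move=> x; apply/ffunP => q; rewrite !ffunE; case: eqP => [->|//].
apply: val_inj => /=; rewrite /antichain_toggle_value.
set S : R := \sum_(C : {set P} | maximal_chain C && (p \in C))
  \prod_(q in C :\ p) (x q)%:num.
have prodE y : (forall q, q != p -> y q = x q) ->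
    \sum_(C : {set P} | maximal_chain C && (p \in C)) \prod_(q in C) (y q)%:num
    = (y p)%:num * S.
  move=> yx; rewrite /S mulr_sumr; apply: eq_bigr => C /andP[_ pC].
  rewrite (big_setD1 p)//=; congr (_ * _); apply: eq_bigr => q'.
  by rewrite !inE => /andP[/yx ->].
rewrite prodE => [|q' /negPf q'p]; last by rewrite ffunE q'p.
rewrite ffunE eqxx /= /antichain_toggle_value prodE//.
have S0 : S != 0.
  apply: contraNneq (lt0r_neq0 (antichain_toggle_value_gt0 x p)) => S0.
  by rewrite /antichain_toggle_value prodE// S0 mulr0 invr0.
by rewrite (invfM (x p)%:num) mulfVK// invrK.
Qed.

Lemma antichain_rowmotion_bij (L : linext P) : bijective (antichain_rowmotion L).
Proof.
rewrite /antichain_rowmotion; elim: {L}(linext_seq L) => [|p e IH] /=.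
  by exists id.
by apply: (bij_comp IH); exists (antichain_toggle p); apply: antichain_toggleK.
Qed.

(* The inverse of antichain rowmotion, which is bijective by
   [antichain_rowmotion_bij]; the default value of [pinv] is never used. *)
Definition antichain_rowmotion_inv (L : linext P) :
    labeling R P -> labeling R P :=
  'pinv_(id) [set: labeling R P]%classic (antichain_rowmotion L).

Lemma antichain_rowmotionK (L : linext P) :
  cancel (antichain_rowmotion L) (antichain_rowmotion_inv L).
Proof.
move=> x; apply: pinvKV; last by rewrite inE.
by move=> y z _ _; apply: (bij_inj (antichain_rowmotion_bij L)).
Qed.

Lemma antichain_rowmotion_invK (L : linext P) :
  cancel (antichain_rowmotion_inv L) (antichain_rowmotion L).
Proof.
by apply/(bij_can_sym (antichain_rowmotion_bij L)); apply: antichain_rowmotionK.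
Qed.

End Rowmotion.

Definition has_order (T : Type) (f : T -> T) (n : nat) : Prop :=
  [/\ (0 < n)%N, iter n f =1 id &
      forall m, (0 < m < n)%N -> ~ (iter m f =1 id)].

Section Shapes.
Local Open Scope nat_scope.
Variables r s : nat.
Implicit Types i j k : nat.

Definition in_rect i j := [&& 1 <= i <= r & 1 <= j <= s].

(* i < r + j stands for i - j < r, to avoid truncated subtraction. *)
Definition in_rtrap i j :=
  [&& 1 <= i <= r + s - 1, 1 <= j <= s & i < r + j].

Definition in_trap i j := in_rtrap i j && (s < i + j).

Definition in_rtrap_itv (a b : nat * nat) i j :=
  [&& in_rtrap i j, a.1 <= i <= b.1 & a.2 <= j <= b.2].

Definition in_M k := in_rtrap_itv (k, 1) (r + k, k.+1).

End Shapes.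

Definition in_inter (r s k i j : nat) : bool :=
  in_trap r k i j || in_rtrap_itv r s (k, k.+1) ((r + k - 1)%N, s) i j.

(* The finite poset of the points (i, j) of [r+s-1] x [s] satisfying A, with
   the componentwise order. Coordinates are the usual 1-based ones: the row and
   the column of index 0 of the ambient grid are not used, as none of the
   predicates above holds there. *)
Definition grid (r s : nat) := ('I_(r + s) *p 'I_s.+1)%type.

Definition subgrid (r s : nat) (A : rel nat) : Type :=
  {p : grid r s | A p.1 p.2}.
HB.instance Definition _ r s A := SubFinite.on (subgrid r s A).
HB.instance Definition _ r s A :=
  [SubChoice_isSubPOrder of subgrid r s A by <: with Order.Disp tt tt].

Definition rectangle (r s : nat) := subgrid r s (in_rect r s).
Definition trapezoid (r s : nat) := subgrid r s (in_trap r s).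
Definition intermediate (r s k : nat) := subgrid r s (in_inter r s k).
Definition Mposet (r s k : nat) := subgrid r s (in_M r s k).

Lemma in_inter1 r s : (0 < r)%N -> (0 < s)%N -> in_inter r s 1 =2 in_rect r s.
Proof.
by move=> r0 s0 i j;
   rewrite /in_inter /in_rtrap_itv /in_trap /in_rtrap /in_rect /=; lia.
Qed.

Lemma in_inters r s : in_inter r s s =2 in_trap r s.
Proof.
by move=> i j; rewrite /in_inter /in_rtrap_itv /in_trap /in_rtrap /=; lia.
Qed.

Section Zeta.
Variables (R : realType) (r s : nat).

(* x_{i,j}, with the junk value 1 when (i, j) is not in the poset. *)
Definition label_at (A : rel nat) (x : labeling R (subgrid r s A)) (i j : nat) :
    {posnum R} :=
  if [pick p : subgrid r s A | ((val p).1 == i :> nat) && ((val p).2 == j :> nat)]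
  is Some p then x p else 1%:pos.

Lemma label_atE (A : rel nat) (x : labeling R (subgrid r s A))
  (p : subgrid r s A) : label_at x (val p).1 (val p).2 = x p.
Proof.
rewrite /label_at; case: pickP => [q /andP[/eqP e1 /eqP e2]|/(_ p)]; last first.
  by rewrite !eqxx.
congr (x _); apply: val_inj.
by case: (val q) (val p) e1 e2 => [? ?] [? ?] /= /val_inj -> /val_inj ->.
Qed.

(* The same labeling seen on another subset of the grid. *)
Definition relabel (A B : rel nat) (x : labeling R (subgrid r s A)) :
    labeling R (subgrid r s B) :=
  [ffun p : subgrid r s B => label_at x (val p).1 (val p).2].

Definition xbar (k : nat) (x : labeling R (intermediate r s k.+1)) :
    labeling R (Mposet r s k) :=
  [ffun p : Mposet r s k =>
     if ((val p).1 == k :> nat) && ((val p).2 == 1%N :> nat) then 1%:pos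
     else label_at x (val p).1 (val p).2].

Variable L : forall k, linext (Mposet r s k).

(* On I_k \ M_k either j > k + 1 or i < k, so the last branch is the third
   case of the definition of zeta_k. *)
Definition zeta_step (k : nat) (x : labeling R (intermediate r s k.+1)) :
    labeling R (intermediate r s k) :=
  [ffun p : intermediate r s k =>
     let i : nat := (val p).1 in let j : nat := (val p).2 in
     if in_M r s k i j then label_at (antichain_rowmotion_inv (L k) (xbar x)) i j
     else if (k.+1 < j)%N then label_at x i.+1 j
     else label_at x i j.+1].

(* zeta_1 o ... o zeta_m *)
Fixpoint zeta_comp (m : nat) :
    labeling R (intermediate r s m.+1) -> labeling R (intermediate r s 1) :=
  match m with
  | 0 => id
  | m'.+1 => zeta_comp (m := m') \o zeta_step (k := m'.+1)
  end.

(* I_s = T and I_1 = R as subsets of the grid (in_inters, in_inter1), so that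
   both relabelings are identifications. *)
Definition zeta (x : labeling R (trapezoid r s)) : labeling R (rectangle r s) :=
  relabel (in_rect r s)
    (zeta_comp (m := s.-1) (relabel (in_inter r s s.-1.+1) x)).

End Zeta.

(* Main.v *)
Require Import Defs.
From mathcomp Require Import all_boot all_order all_algebra.
From mathcomp Require Import reals.
From mathcomp Require Import interval_inference zify ring lra.

(* Antichain rowmotion sends [x] to [y] exactly when there is a potential [D > 0]
   such that [D p] is the sum of the [y]-weights of the saturated chains from a
   minimal element up to [p], and [1 / D p] the sum of the [x]-weights of the
   saturated chains from [p] up to a maximal element. When [A] is a solution of
   the linear recurrence [A p = y p * (A left + A below)], the differences of
   [A / D] across the unit squares, scaled by [D], solve the same recurrence for
   [x] (a discrete stream function). On the trapezoid this exchanges solutions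
   vanishing just outside the wall [i - j = r - 1] with solutions vanishing on
   the wall, because the wall reflects.

   To a labeling of the trapezoid or of the rectangle one attaches the space of
   the restrictions of these solutions to the top row and to the initial
   boundary: an [s]-dimensional space of functions on [r + s] points, i.e. a point
   of a Grassmannian. Taking on the trapezoid solutions of the first kind for half
   of the sources and of the second kind for the other half, rowmotion becomes the
   signed cyclic shift of the [r + s] points for both posets. The composite of the
   maps [zeta_k] preserves the space, although the single [zeta_k] does not commute
   with rowmotion. As a labeling of the rectangle is determined by its space and
   [zeta] is injective, equivariance and period [r + s] follow. A smaller period is
   excluded by scaling the label of the maximum of the trapezoid, which scales a
   single one of the [r + s] points. *)

Set Implicit Arguments.
Unset Strict Implicit.
Unset Printing Implicit Defensive.

Import Order.TTheory GRing.Theory Num.Theory.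
Local Open Scope ring_scope.

(** * Saturated chains from a minimal element up to a given element *)

Section LowerChains.
Variables (d : Order.disp_t) (P : finPOrderType d).
Implicit Types (p q : P) (A C : {set P}).

(** Maximality is required only among the elements below [p], so [A] is a maximal chain of the
    principal ideal of [p]. *)
Definition lower_chain p A :=
  [&& p \in A, [forall a in A, (a <= p)%O], chain A &
      [forall q : P, (q <= p)%O && [forall a in A, (q >=< a)%O] ==> (q \in A)]].

Lemma chainP A :
  reflect {in A &, forall p q, (p >=< q)%O} (chain A).
Proof.
apply: (iffP idP) => [h p q pA qA|h].
  by have /forallP/(_ p)/implyP/(_ pA)/forallP/(_ q)/implyP/(_ qA) := h.
apply/forallP => p; apply/implyP => pA; apply/forallP => q; apply/implyP => qA.
exact: h.
Qed.

Lemma lower_chainP p A :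
  reflect [/\ p \in A, forall a, a \in A -> (a <= p)%O,
              {in A &, forall p q, (p >=< q)%O} &
              forall q, (q <= p)%O -> (forall a, a \in A -> (q >=< a)%O) -> q \in A]
          (lower_chain p A).
Proof.
apply: (iffP and4P) => -[pA h1 h2 h3]; split=> //.
- exact: (forall_inP h1).
- exact/chainP.
- move=> q qp h; apply: (implyP (forallP h3 q)).
  by rewrite qp; apply/forall_inP.
- exact/forall_inP.
- exact/chainP.
- apply/forallP => q; apply/implyP => /andP[qp /forall_inP]; exact: h3.
Qed.

Lemma maximal_chainP C :
  reflect ({in C &, forall p q, (p >=< q)%O} /\
           forall q, (forall a, a \in C -> (q >=< a)%O) -> q \in C)
          (maximal_chain C).
Proof.
rewrite /maximal_chain; apply: (iffP maxsetP) => -[h1 h2]; split.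
- exact/chainP.
- move=> q hq; rewrite -(h2 (q |: C)) ?setU11 ?subsetUr//.
  move/chainP: h1 => h1; apply/chainP => a b.
  rewrite !inE => /orP[/eqP ->|aC] /orP[/eqP ->|bC]; rewrite ?comparablexx ?hq//.
  - by rewrite comparable_sym hq.
  - exact: h1.
- exact/chainP.
- move=> B /chainP hB CB; apply/eqP; rewrite eqEsubset CB andbT.
  apply/fintype.subsetP => q qB; apply: h2 => a aC.
  by apply: hB => //; apply: (fintype.subsetP CB).
Qed.

Lemma covered_byP p q :
  reflect ((p < q)%O /\ forall c, (p < c)%O -> (c < q)%O -> False) (covered_by p q).
Proof.
apply: (iffP andP) => -[pq h]; split=> //.
  by move=> c pc cq; have := forallP h c; rewrite pc cq.
by apply/forallP => c; apply/negP => /andP[]; apply: h.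
Qed.

Lemma lower_chain_cons q p A :
  covered_by q p -> lower_chain q A -> lower_chain p (p |: A) && (p \notin A).
Proof.
move=> /covered_byP[qp cov] /lower_chainP[qA le_q chA mxA].
have pA : p \notin A by apply/negP => /le_q /(lt_le_trans qp); rewrite ltxx.
rewrite pA andbT; apply/lower_chainP; split.
- exact: setU11.
- by move=> a /setU1P[->//|/le_q aq]; apply: le_trans aq (ltW qp).
- have lep a : a \in A -> (a <= p)%O by move=> /le_q aq; apply: le_trans aq (ltW qp).
  move=> a b /setU1P[->|aA] /setU1P[->|bA]; rewrite ?comparablexx//.
  + by rewrite comparable_sym le_comparable ?lep.
  + by rewrite le_comparable ?lep.
  + exact: chA.
- move=> c cp hc; rewrite !inE; case: eqVneq => //= cnp.
  have {cnp}cp : (c < p)%O by rewrite lt_neqAle cnp.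
  apply: mxA => [|a aA]; last by apply: hc; rewrite inE aA orbT.
  have : (c >=< q)%O by apply: hc; rewrite inE qA orbT.
  case/comparable_leP => // qc; case: (cov c qc cp).
Qed.

Lemma lower_chain_behead q p A :
  covered_by q p -> lower_chain p A -> q \in A -> lower_chain q (A :\ p).
Proof.
move=> /covered_byP[qp cov] /lower_chainP[pA le_p chA mxA] qA.
have le_q a : a \in A :\ p -> (a <= q)%O.
  rewrite !inE => /andP[anp aA].
  case/comparable_leP: (chA _ _ aA qA) => // qa.
  by case: (cov a qa); rewrite lt_neqAle anp le_p.
apply/lower_chainP; split=> //.
- by rewrite !inE qA andbT lt_eqF.
- by move=> a b /setD1P[_ aA] /setD1P[_ bA]; apply: chA.
- move=> c cq hc; rewrite !inE lt_eqF ?(le_lt_trans cq qp)//=.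
  apply: mxA => [|a aA]; first exact: le_trans cq (ltW qp).
  case: (eqVneq a p) => [->|anp]; last by apply: hc; rewrite !inE anp.
  by rewrite le_comparable// (le_trans cq (ltW qp)).
Qed.

Lemma lower_chain_has_cover p q0 A :
  lower_chain p A -> (q0 < p)%O -> exists2 q, q \in A & covered_by q p.
Proof.
move=> /lower_chainP[pA le_p chA mxA] q0p.
have [a aAp] : exists a, a \in A :\ p.
  apply/set0Pn/eqP => A0.
  have : q0 \in A.
    apply: mxA => [|a aA]; first exact: ltW.
    case: (eqVneq a p) => [->|anp]; first by rewrite le_comparable ?ltW.
    by have : a \in A :\ p; [rewrite !inE anp|rewrite A0 inE].
  move=> q0A; have : q0 \in A :\ p by rewrite !inE q0A lt_eqF.
  by rewrite A0 inE.
(* The number of elements strictly below grows along the chain, so its maximizer is the top of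
   [A :\ p]; maximality of [A] leaves nothing between it and [p]. *)
case: (@arg_maxnP _ a (fun a => a \in A :\ p)
  (fun a => #|[set e : P | (e < a)%O]|) aAp) => q qAp qmax.
have /setD1P[qnp qA] := qAp; exists q => //; apply/covered_byP; split.
  by rewrite lt_neqAle qnp le_p.
have le_q b : b \in A :\ p -> (b <= q)%O.
  move=> bAp; have /setD1P[bnp bA] := bAp.
  case/comparable_leP: (chA _ _ bA qA) => // qb.
  have /= := qmax b bAp; rewrite /geq /= leqNgt => /negP[]; apply: proper_card.
  apply/properP; split; last by exists q; rewrite !inE ?ltxx.
  by apply/fintype.subsetP => f; rewrite !inE => /lt_trans; apply.
move=> c qc cp.
have cA : c \in A.
  apply: mxA => [|b bA]; first exact: ltW.
  case: (eqVneq b p) => [->|bnp]; first by rewrite le_comparable ?ltW.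
  have bq : (b <= q)%O by apply: le_q; rewrite !inE bnp.
  by rewrite comparable_sym le_comparable// (le_trans bq (ltW qc)).
have : (c <= q)%O by apply: le_q; rewrite !inE cA lt_eqF.
by move=> /(lt_le_trans qc); rewrite ltxx.
Qed.

Lemma lower_chain_cover_unique p q q' A : lower_chain p A ->
  q \in A -> covered_by q p -> q' \in A -> covered_by q' p -> q = q'.
Proof.
move=> /lower_chainP[_ _ chA _] qA /covered_byP[qp cov] q'A /covered_byP[q'p cov'].
case/comparable_ltgtP: (chA _ _ qA q'A) => // h.
- by case: (cov _ h q'p).
- by case: (cov' _ h qp).
Qed.

End LowerChains.

(** * Chain sums and their recursion along covers *)

Section ChainSums.
Variables (R : comPzRingType) (d : Order.disp_t) (P : finPOrderType d).
Implicit Types (p q : P) (A B C : {set P}) (w : P -> R).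

Definition down w p : R :=
  \sum_(A : {set P} | lower_chain p A) \prod_(q in A) w q.

Lemma eq_down w w' p :
  (forall q, (q <= p)%O -> w q = w' q) -> down w p = down w' p.
Proof.
move=> ww'; apply: eq_bigr => A /lower_chainP[_ le_p _ _].
by apply: eq_bigr => q /le_p /ww'.
Qed.

Lemma down_min w p : (forall q, ~~ (q < p)%O) -> down w p = w p.
Proof.
move=> pmin; rewrite /down (big_pred1 [set p]) ?big_set1//.
move=> A /=; apply/lower_chainP/eqP => [[pA le_p _ _]|->].
  apply/setP => a; rewrite inE; apply/idP/eqP => [/le_p|->//].
  by rewrite le_eqVlt (negPf (pmin a)) orbF => /eqP.
split=> [|a|a b|q]; rewrite ?inE//.
- by move=> /eqP ->.
- by move=> /eqP -> /eqP ->; rewrite comparablexx.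
- by rewrite le_eqVlt (negPf (pmin q)) orbF => /eqP ->; rewrite ?inE.
Qed.

(** A saturated chain ending at a non-minimal [p] contains exactly one element covered by [p], and
    deleting [p] is a bijection onto the chains ending at such elements. *)
Lemma down_rec w p q0 : (q0 < p)%O ->
  down w p = w p * \sum_(q | covered_by q p) down w q.
Proof.
move=> q0p; rewrite /down.
under eq_bigr => A hA.
  have [q qA qp] := lower_chain_has_cover hA q0p.
  rewrite (_ : \prod_(q in A) w q =
    \sum_(q' | covered_by q' p && (q' \in A)) \prod_(q in A) w q); last first.
    rewrite [RHS](big_pred1 q)// => q' /=; apply/andP/eqP => [[q'p q'A]|->//].
    exact: (lower_chain_cover_unique hA).
  over.
rewrite (exchange_big_dep (fun q => covered_by q p))/=; last by move=> A q _ /andP[].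
rewrite mulr_sumr; apply: eq_bigr => q qp; rewrite mulr_sumr.
rewrite (reindex_onto (fun A => p |: A) (fun A => A :\ p)) /=; last first.
  by move=> A /andP[/lower_chainP[pA _ _ _] _]; rewrite setD1K.
have qnp : q != p by case/covered_byP: qp => /lt_eqF ->.
apply: eq_big => [A|A].
  apply/idP/idP => [|hA]; last first.
    have /andP[hpA pA] := lower_chain_cons qp hA.
    rewrite hpA qp /= setU1K ?eqxx// inE.
    by case/lower_chainP: hA => ->; rewrite orbT.
  move=> /andP[/andP[hA /andP[_ qA]] /eqP <-].
  by apply: lower_chain_behead.
move=> /andP[_ /eqP <-]; by rewrite big_setU1 ?setD11.
Qed.

End ChainSums.

(** * Maximal chains through a point, cut at that point *)

Section MaximalChainSums.
Variables (R : comPzRingType) (d : Order.disp_t) (P : finPOrderType d).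
Implicit Types (p q : P) (A B C : {set P}) (w : P -> R).

(** Passing to the dual order lets the lemmas on [down] be reused. *)
Definition up w p : R := @down R _ P^d w p.

Lemma covered_by_dual p q : @covered_by _ P^d p q = covered_by q p.
Proof.
by apply/covered_byP/covered_byP => -[pq h]; split=> // c h1 h2; apply: (h c).
Qed.

Lemma eq_up w w' p :
  (forall q, (p <= q)%O -> w q = w' q) -> up w p = up w' p.
Proof. by move=> ww'; apply: eq_down => q; apply: ww'. Qed.

Lemma up_max w p : (forall q, ~~ (p < q)%O) -> up w p = w p.
Proof. by move=> pmax; apply: down_min. Qed.

Lemma up_rec w p q0 : (p < q0)%O ->
  up w p = w p * \sum_(q | covered_by p q) up w q.
Proof.
move=> pq0; rewrite /up (@down_rec R _ P^d w p q0)//.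
by congr (_ * _); apply: eq_bigl => q; rewrite covered_by_dual.
Qed.

(** A maximal chain through [p] is cut at [p] into a saturated chain below and one above. Both
    halves contain [p], which accounts for the extra factor [w p]. *)
Lemma maximal_chain_sum w p :
  (\sum_(C : {set P} | maximal_chain C && (p \in C)) \prod_(q in C) w q) * w p
  = down w p * up w p.
Proof.
rewrite /up /down big_distrlr /= pair_big mulr_suml /=.
rewrite (reindex_onto (fun AB => AB.1 :|: AB.2)
  (fun C => (C :&: [set q | (q <= p)%O], C :&: [set q | (p <= q)%O]))) /=; last first.
  move=> C /andP[/maximal_chainP[chC _] pC]; rewrite -setIUr.
  apply/setIidPl/fintype.subsetP => q qC; rewrite !inE.
  exact: chC.
apply: eq_big => [[A B] /=|[A B] /=].
  apply/andP/andP.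
  - move=> [/andP[/maximal_chainP[chC mxC] pC] /eqP[eA eB]].
    have inA q : q \in A = (q \in A :|: B) && (q <= p)%O by rewrite -{1}eA !inE.
    have inB q : q \in B = (q \in A :|: B) && (p <= q)%O by rewrite -{1}eB !inE.
    split.
    + apply/lower_chainP; split.
      * by rewrite inA pC lexx.
      * by move=> a; rewrite inA => /andP[].
      * by move=> a b; rewrite !inA => /andP[aC _] /andP[bC _]; apply: chC.
      * move=> q qp hq; rewrite inA qp andbT; apply: mxC => a.
        rewrite inE => /orP[/hq//|]; rewrite inB => /andP[_ pa].
        by rewrite le_comparable// (le_trans qp pa).
    + apply/(@lower_chainP _ P^d); split.
      * by rewrite inB pC lexx.
      * by move=> a; rewrite inB => /andP[].
      * move=> a b; rewrite !inB => /andP[aC _] /andP[bC _].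
        by rewrite /Order.comparable orbC; apply: chC.
      * move=> q pq hq; rewrite inB; apply/andP; split; last exact: pq.
        apply: mxC => a; rewrite inE => /orP[|/hq].
          rewrite inA => /andP[_ ap]; rewrite comparable_sym le_comparable//.
          exact: (le_trans ap pq).
        by rewrite /Order.comparable orbC.
  - move=> [/lower_chainP[pA le_p chA mxA] /(@lower_chainP _ P^d)[pB ge_p chB mxB]].
    have {}ge_p a : a \in B -> (p <= a)%O by apply: ge_p.
    have chB' a b : a \in B -> b \in B -> (a >=< b)%O.
      by move=> aB bB; have := chB _ _ aB bB; rewrite /Order.comparable orbC.
    have cAB a b : a \in A -> b \in B -> (a >=< b)%O.
      by move=> aA bB; rewrite le_comparable// (le_trans (le_p _ aA) (ge_p _ bB)).
    split; last first.
      rewrite xpair_eqE; apply/andP; split; apply/eqP/setP => q; rewrite !inE.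
      + apply/andP/idP => [[/orP[//|qB] qp]|qA]; last by rewrite qA le_p.
        suff -> : q = p by [].
        by apply/eqP; rewrite eq_le qp ge_p.
      + apply/andP/idP => [[/orP[qA|//] qp]|qB]; last by rewrite qB orbT ge_p.
        suff -> : q = p by [].
        by apply/eqP; rewrite eq_le qp le_p.
    rewrite inE pA andbT; apply/maximal_chainP; split.
      move=> a b; rewrite !inE => /orP[aA|aB] /orP[bA|bB].
      * exact: chA.
      * exact: cAB.
      * by rewrite comparable_sym cAB.
      * exact: chB'.
    move=> q hq; rewrite inE.
    have : (q >=< p)%O by apply: hq; rewrite inE pA.
    case/orP => [qp|pq].
      by rewrite mxA// => a aA; apply: hq; rewrite inE aA.
    rewrite [q \in B]mxB ?orbT// => a aB.
    by rewrite /Order.comparable orbC; apply: hq; rewrite inE aB orbT.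
move=> /andP[/andP[/maximal_chainP[_ _] pC] /eqP[eA eB]].
have pA : p \in A by rewrite -eA inE pC inE lexx.
have pB : p \in B by rewrite -eB inE pC inE lexx.
rewrite [\prod_(i in B) _](big_setD1 p)//=.
rewrite (_ : A :|: B = A :|: (B :\ p)); last first.
  by apply/setP => q; rewrite !inE; case: eqVneq => //= ->; rewrite pA.
rewrite (eq_bigl [predU A & B :\ p]) => [|q]; last by rewrite !inE.
rewrite bigU /=; first by rewrite mulrCA mulrC.
rewrite disjoints_subset; apply/fintype.subsetP => q.
rewrite -eA -eB !inE negb_and negbK => /andP[_ qp].
by case: eqVneq => //= qnp; apply/negP => /andP[_ pq]; case/negP: qnp; rewrite eq_le qp.
Qed.

End MaximalChainSums.

(** * Positivity of chain sums *)

Section Positivity.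
Variables (R : realDomainType) (d : Order.disp_t) (P : finPOrderType d).
Implicit Types (p q : P) (w : P -> R).

Lemma down_up_gt0 w p : (forall q, 0 < w q) -> 0 < down w p * up w p.
Proof.
move=> w_gt0; rewrite -maximal_chain_sum mulr_gt0//.
have [C mC pC] := ex_maximal_chain p.
rewrite (bigD1 C) ?mC//= ltr_pwDl ?prodr_gt0//.
by rewrite sumr_ge0// => D _; rewrite prodr_ge0// => q _; apply: ltW.
Qed.

Lemma down_gt0 w p : (forall q, 0 < w q) -> 0 < down w p.
Proof.
move=> w_gt0; rewrite lt_def; apply/andP; split.
  by apply: contraTneq (down_up_gt0 p w_gt0) => ->; rewrite mul0r ltxx.
by rewrite sumr_ge0// => A _; rewrite prodr_ge0// => q _; apply: ltW.
Qed.

End Positivity.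

Lemma up_gt0 (R : realDomainType) (d : Order.disp_t) (P : finPOrderType d)
  (w : P -> R) (p : P) : (forall q, 0 < w q) -> 0 < up w p.
Proof. exact: (@down_gt0 R _ P^d). Qed.

(** * Covers in the poset with adjoined minimum and maximum *)

Section HatCovers.
Variables (d : Order.disp_t) (P : finPOrderType d).
Implicit Types (p q : P).

Lemma hat_in_lt p q : (hat_in p < hat_in q)%O = (p < q)%O.
Proof.
rewrite !lt_neqAle; congr andb; apply/idP/idP; by apply: contraNneq => [[->]|->].
Qed.

Lemma covered_by_hat_in p q : covered_by (hat_in p) (hat_in q) = covered_by p q.
Proof.
apply/covered_byP/covered_byP; rewrite hat_in_lt => -[pq h]; split=> //.
  by move=> c pc cq; apply: (h (hat_in c)); rewrite hat_in_lt.
by case=> [[c|]|] //; rewrite !hat_in_lt; apply: h.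
Qed.

Lemma hat_lower_covers (R : nmodType) (F : hat P -> R) p q0 : (q0 < p)%O ->
  \sum_(a : hat P | covered_by a (hat_in p)) F a =
  \sum_(q | covered_by q p) F (hat_in q).
Proof.
move=> q0p.
rewrite (reindex_onto (@hat_in _ P)
  (fun a : hat P => if a is Some (Some q) then q else p)) /=.
  by apply: eq_bigl => q; rewrite covered_by_hat_in eqxx andbT.
case=> [[q|]|] //= /covered_byP[lt_p h].
by case: (h (hat_in q0)); rewrite ?hat_bot_lt ?hat_in_lt.
Qed.

Lemma hat_lower_covers_min (R : nmodType) (F : hat P -> R) p :
  (forall q, ~~ (q < p)%O) ->
  \sum_(a : hat P | covered_by a (hat_in p)) F a = F (hat_bot P).
Proof.
move=> pmin; rewrite (big_pred1 (hat_bot P))// => a /=.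
apply/covered_byP/eqP => [[]|->].
  by case: a => [[q|]|]//; rewrite hat_in_lt (negPf (pmin q)).
split=> [|c]; first exact: hat_bot_lt.
by case: c => [[q|]|] // _; rewrite hat_in_lt (negPf (pmin q)).
Qed.

Lemma hat_upper_covers (R : nmodType) (F : hat P -> R) p q0 : (p < q0)%O ->
  \sum_(a : hat P | covered_by (hat_in p) a) F a =
  \sum_(q | covered_by p q) F (hat_in q).
Proof.
move=> pq0.
rewrite (reindex_onto (@hat_in _ P)
  (fun a : hat P => if a is Some (Some q) then q else p)) /=.
  by apply: eq_bigl => q; rewrite covered_by_hat_in eqxx andbT.
case=> [[q|]|] //= /covered_byP[lt_p h].
by case: (h (hat_in q0)); rewrite ?hat_lt_top ?hat_in_lt.
Qed.

Lemma hat_upper_covers_max (R : nmodType) (F : hat P -> R) p :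
  (forall q, ~~ (p < q)%O) ->
  \sum_(a : hat P | covered_by (hat_in p) a) F a = F (hat_top P).
Proof.
move=> pmax; rewrite (big_pred1 (hat_top P))// => a /=.
apply/covered_byP/eqP => [[]|->].
  by case: a => [[q|]|]//; rewrite hat_in_lt (negPf (pmax q)).
split=> [|c]; first exact: hat_lt_top.
by case: c => [[q|]|] //; rewrite hat_in_lt (negPf (pmax q)).
Qed.

End HatCovers.

(** * Prefixes and suffixes of linear extensions *)

Section LinearExtensions.
Variables (d : Order.disp_t) (P : finPOrderType d) (L : linext P).
Implicit Types (p q : P).

Lemma linext_uniq : uniq L.
Proof. by case/and3P: (linextP L). Qed.

Lemma linext_mem p : p \in linext_seq L.
Proof. by case/and3P: (linextP L) => _ /forallP/(_ p). Qed.

Lemma linext_lt p q : (p < q)%O -> (index p L < index q L)%N.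
Proof. by case/and3P: (linextP L) => _ _ /forallP/(_ p)/forallP/(_ q)/implyP. Qed.

Lemma linext_below e1 p e2 q :
  linext_seq L = e1 ++ p :: e2 -> (q < p)%O -> q \in e1.
Proof.
move=> eL /linext_lt; have := linext_uniq; rewrite eL cat_uniq /= => /and3P[_ H _].
have pe1 : p \notin e1 by case/norP: H.
by rewrite !index_cat (negPf pe1) /= eqxx addn0; case: ifP => // _; rewrite ltnNge leq_addr.
Qed.

Lemma linext_above e1 p e2 q :
  linext_seq L = e1 ++ p :: e2 -> (p < q)%O -> q \in e2.
Proof.
move=> eL pq; have := linext_mem q; rewrite eL mem_cat inE gt_eqF //=.
case/orP => // qe1; have := linext_lt pq.
have := linext_uniq; rewrite eL cat_uniq /= => /and3P[_ H _].
have pe1 : p \notin e1 by case/norP: H.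
by rewrite !index_cat qe1 (negPf pe1) /= eqxx addn0 ltnNge index_size.
Qed.

Lemma linext_notin e1 p e2 : linext_seq L = e1 ++ p :: e2 ->
  (p \notin e1) /\ (p \notin e2).
Proof.
move=> eL; have := linext_uniq; rewrite eL cat_uniq /=.
by case/and3P => _ /norP[? _] /andP[].
Qed.

Lemma linext_disj e1 e2 q : linext_seq L = e1 ++ e2 -> q \in e1 -> q \in e2 -> False.
Proof.
move=> eL q1 q2; have := linext_uniq; rewrite eL cat_uniq => /and3P[_ /hasPn H _].
by have /negP := H _ q2; apply.
Qed.

End LinearExtensions.

(** * Both rowmotions in terms of chain sums *)

Section Rowmotion.
Variables (R : realType) (d : Order.disp_t) (P : finPOrderType d) (L : linext P).
Implicit Types (x y : labeling R P) (p q : P).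

Definition lnum x p : R := (x p)%:num.

Lemma lnum_gt0 x p : 0 < lnum x p.
Proof. by rewrite /lnum. Qed.

Lemma lnum_inj x y : lnum x =1 lnum y -> x = y.
Proof. by move=> xy; apply/ffunP => p; apply: val_inj; apply: xy. Qed.

Lemma antichain_toggleE x p : lnum (antichain_toggle p x) p =
  lnum x p / (down (lnum x) p * up (lnum x) p).
Proof.
rewrite -maximal_chain_sum /lnum ffunE eqxx /= /antichain_toggle_value.
by rewrite invfM mulrCA divff ?mulr1// (lt0r_neq0 (lnum_gt0 x p)).
Qed.

(** [down w p] is linear in [w p], with a coefficient that involves only the labels strictly below
    [p]. *)
Lemma down_scale (w w' : P -> R) p : (forall q, (q < p)%O -> w q = w' q) ->
  down w p * w' p = down w' p * w p.
Proof.
move=> ww'; case: (pickP (fun q => (q < p)%O)) => [q0 q0p|pmin].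
  rewrite !(down_rec _ q0p) mulrAC [RHS]mulrAC [w' p * _]mulrC; congr (_ * _ * _).
  apply: eq_bigr => q /covered_byP[qp _]; apply: eq_down => c cq.
  by apply: ww'; apply: le_lt_trans cq qp.
by rewrite !down_min 1?mulrC// => q; rewrite pmin.
Qed.

(** When [p] is toggled, the labels above it are still those of [x]. The toggle divides the label by
    the current [down * up], hence divides [down] by the same amount and leaves [1 / up]. Later
    toggles do not touch anything below [p]. In the invariant, [e1] is the part already toggled. *)
Lemma antichain_rowmotion_down x p :
  down (lnum (antichain_rowmotion L x)) p = (up (lnum x) p)^-1.
Proof.
suff H e2 e1 y : linext_seq L = e1 ++ e2 ->
    (forall q, q \notin e1 -> lnum y q = lnum x q) ->
    (forall q, q \in e1 -> down (lnum y) q = (up (lnum x) q)^-1) ->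
    forall q, down (lnum (foldl (fun y p => antichain_toggle p y) y e2)) q
              = (up (lnum x) q)^-1.
  by apply: (H _ [::]).
elim: e2 e1 y => [|c e2 IH] e1 y eL yx yd q /=.
  by apply: yd; have := linext_mem L q; rewrite eL cats0.
have [ce1 ce2] := linext_notin eL.
have tE a : a != c -> lnum (antichain_toggle c y) a = lnum y a.
  by move=> /negPf ac; rewrite /lnum ffunE ac.
have above a : (c <= a)%O -> a \notin e1.
  rewrite le_eqVlt => /predU1P[<-//|/(linext_above eL) ae2].
  by apply/negP => /(linext_disj eL); apply; rewrite inE ae2 orbT.
apply: (IH (rcons e1 c)).
- by rewrite cat_rcons.
- by move=> a; rewrite mem_rcons inE => /norP[ac ae]; rewrite tE ?yx.
- move=> a; rewrite mem_rcons inE => /predU1P[->|ae]; last first.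
    rewrite -yd//; apply: eq_down => b ba; apply: tE.
    apply: contraTneq ae => bc; apply: above; rewrite -bc //.
  have upE : up (lnum y) c = up (lnum x) c.
    by apply: eq_up => b cb; apply: yx; apply: above.
  have /down_scale : forall b, (b < c)%O -> lnum (antichain_toggle c y) b = lnum y b.
    by move=> b bc; apply: tE; rewrite lt_eqF.
  rewrite antichain_toggleE upE => E.
  have yc0 := lt0r_neq0 (lnum_gt0 y c).
  have d0 : down (lnum y) c != 0 by rewrite gt_eqF// down_gt0// => b; apply: lnum_gt0.
  have u0 : up (lnum x) c != 0 by rewrite gt_eqF// up_gt0// => b; apply: lnum_gt0.
  by apply: (mulIf yc0); rewrite E; field; apply/andP.
Qed.

(** Toggling starts at the top: above [p] the labels are already [1 / up], below it still [down]. By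
    the recursions the two sums over covers are [up / x] and [down / x], so the toggle replaces
    [down] by [1 / up]. *)
Lemma rowmotion_down x y p : lnum y =1 down (lnum x) ->
  lnum (rowmotion L y) p = (up (lnum x) p)^-1.
Proof.
move=> yx.
suff H e2 e1 : linext_seq L = e1 ++ e2 -> forall q,
    lnum (foldr (@toggle R d P) y e2) q =
    if q \in e2 then (up (lnum x) q)^-1 else lnum y q.
  by rewrite /rowmotion (H _ [::]) ?linext_mem.
elim: e2 e1 => [|c e2 IH] e1 eL q //=.
have {}IH := IH (rcons e1 c); rewrite cat_rcons in IH; have {}IH := IH eL.
set z := foldr _ _ _ in IH *.
rewrite /lnum ffunE inE; case: eqVneq => [->|qc] /=; last exact: IH.
have [ce1 ce2] := linext_notin eL.
have xc0 := lt0r_neq0 (lnum_gt0 x c).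
have dc0 : down (lnum x) c != 0 by rewrite gt_eqF// down_gt0// => b; apply: lnum_gt0.
have uc0 : up (lnum x) c != 0 by rewrite gt_eqF// up_gt0// => b; apply: lnum_gt0.
have zc : (z c)%:num = down (lnum x) c.
  by rewrite -/(lnum z c) IH (negPf ce2) yx.
have below : \sum_(a : hat P | covered_by a (hat_in c)) (hat_label z a)%:num
    = down (lnum x) c / lnum x c.
  case: (pickP (fun q => (q < c)%O)) => [q0 q0c|cmin].
    rewrite (hat_lower_covers _ q0c) (down_rec _ q0c) mulrC mulKf//.
    apply: eq_bigr => a /covered_byP[ac _] /=.
    rewrite -/(lnum z a) IH ifN ?yx//; apply/negP => ae2.
    apply: (linext_disj eL (linext_below eL ac)); by rewrite inE ae2 orbT.
  have cmin' a : ~~ (a < c)%O by rewrite cmin.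
  by rewrite hat_lower_covers_min// down_min//= divff.
have above : \sum_(a : hat P | covered_by (hat_in c) a) ((hat_label z a)%:num)^-1
    = up (lnum x) c / lnum x c.
  case: (pickP (fun q => (c < q)%O)) => [q0 q0c|cmin].
    rewrite (hat_upper_covers _ q0c) (up_rec _ q0c) mulrC mulKf//.
    apply: eq_bigr => a /covered_byP[ac _] /=.
    by rewrite -/(lnum z a) IH (linext_above eL ac) invrK.
  have cmin' a : ~~ (c < a)%O by rewrite cmin.
  by rewrite hat_upper_covers_max// up_max//= invr1 divff.
by rewrite /toggle_value below above zc; field; apply/and3P.
Qed.

Lemma down_label_gt0 x p : 0 < down (lnum x) p.
Proof. by apply: down_gt0 => q; apply: lnum_gt0. Qed.

(** This is the birational transfer map; it conjugates antichain rowmotion to rowmotion. *)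
Definition down_label x : labeling R P := [ffun p => PosNum (down_label_gt0 x p)].

Lemma down_labelE x p : lnum (down_label x) p = down (lnum x) p.
Proof. by rewrite /lnum ffunE. Qed.

Lemma rowmotion_down_label x :
  rowmotion L (down_label x) = down_label (antichain_rowmotion L x).
Proof.
apply: lnum_inj => p; rewrite (@rowmotion_down x) => [|q]; last exact: down_labelE.
by rewrite down_labelE antichain_rowmotion_down.
Qed.

Lemma down_label_inj : injective down_label.
Proof.
move=> x y xy; have {xy}E q : down (lnum x) q = down (lnum y) q.
  by rewrite -!down_labelE xy.
apply: lnum_inj => p.
case: (pickP (fun q => (q < p)%O)) => [q0 q0p|pmin].
  have := E p; rewrite !(down_rec _ q0p) (eq_bigr (down (lnum y))) => [|q _]; last exact: E.
  apply: mulIf; apply/eqP => S0.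
  have := down_label_gt0 y p; rewrite (down_rec _ q0p) S0 mulr0 ltxx//.
by have := E p; rewrite !down_min// => q; rewrite pmin.
Qed.

(** This formula inverts the transfer map [down_label]. *)
Definition undown_value y p : R :=
  lnum y p / \sum_(a : hat P | covered_by a (hat_in p)) (hat_label y a)%:num.

Lemma undown_value_gt0 y p : 0 < undown_value y p.
Proof.
have [b bp] := ex_covered_by_down (hat_bot_lt p).
rewrite divr_gt0// ?lnum_gt0//.
by rewrite (bigD1 b)//= ltr_pwDl// sumr_ge0.
Qed.

Lemma down_label_surj y : exists x, down_label x = y.
Proof.
exists [ffun p => PosNum (undown_value_gt0 y p)]; apply: lnum_inj => p.
rewrite down_labelE; set x := finfun _.
have xE q : lnum x q = undown_value y q by rewrite /lnum ffunE.
have [n] := ubnP #|[set q | (q < p)%O]|; elim: n p => // n IH p; rewrite ltnS => pn.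
have xp := lt0r_neq0 (lnum_gt0 x p).
case: (pickP (fun q => (q < p)%O)) => [q0 q0p|pmin].
  rewrite (down_rec _ q0p) xE /undown_value (hat_lower_covers _ q0p).
  have -> : \sum_(q | covered_by q p) down (lnum x) q =
      \sum_(q | covered_by q p) (hat_label y (hat_in q))%:num.
    apply: eq_bigr => q /covered_byP[qp _]; apply: IH.
    apply: leq_trans pn; apply: proper_card.
    apply/properP; split; last by exists q; rewrite !inE ?ltxx.
    by apply/fintype.subsetP => f; rewrite !inE => /lt_trans; apply.
  rewrite divfK//; apply: contraNneq xp => S0.
  by rewrite xE /undown_value (hat_lower_covers _ q0p) S0 invr0 mulr0.
have pmin' a : ~~ (a < p)%O by rewrite pmin.
by rewrite down_min// xE /undown_value hat_lower_covers_min//= divr1.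
Qed.

Lemma iter_rowmotion_down_label m x :
  iter m (rowmotion L) (down_label x) = down_label (iter m (antichain_rowmotion L) x).
Proof. by elim: m => //= m ->; rewrite rowmotion_down_label. Qed.

Lemma has_order_rowmotion n : has_order (@antichain_rowmotion R d P L) n ->
  has_order (@rowmotion R d P L) n.
Proof.
move=> [n_gt0 idn ltn]; split=> // [y|m mn idm].
  by have [x <-] := down_label_surj y; rewrite iter_rowmotion_down_label idn.
apply: (ltn m mn) => x; apply: down_label_inj.
by rewrite -iter_rowmotion_down_label idm.
Qed.

End Rowmotion.

(** * Cover relations, labels and potentials on subsets of the grid *)

Section GridPotentials.
Variables (R : realType) (r s : nat) (A : rel nat).
Local Notation P := (subgrid r s A).
Implicit Types (p q : P) (x : labeling R P).

(* [A] is graded: its cover relations are unit steps of the grid. *)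
Hypothesis A_bound : forall i j, A i j -> (0 < i < r + s)%N && (0 < j <= s)%N.
Hypothesis A_graded : forall i j k l, A i j -> A k l -> (i <= k)%N -> (j <= l)%N ->
  (i, j) != (k, l) -> ((i < k)%N && A i.+1 j) || ((j < l)%N && A i j.+1).

Definition abscissa p : nat := (val p).1.
Definition ordinate p : nat := (val p).2.

Lemma in_subgrid p : A (abscissa p) (ordinate p).
Proof. exact: (valP p). Qed.

Lemma subgrid_eq p q : abscissa p = abscissa q -> ordinate p = ordinate q -> p = q.
Proof.
rewrite /abscissa /ordinate => e1 e2; apply: val_inj.
by case: (val p) (val q) e1 e2 => [? ?] [? ?] /= /val_inj -> /val_inj ->.
Qed.

Lemma subgrid_le p q :
  (p <= q)%O = (abscissa p <= abscissa q)%N && (ordinate p <= ordinate q)%N.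
Proof. by []. Qed.

Lemma subgrid_lt p q : (p < q)%O =
  [&& (abscissa p <= abscissa q)%N, (ordinate p <= ordinate q)%N
    & (abscissa p, ordinate p) != (abscissa q, ordinate q)].
Proof.
rewrite lt_neqAle subgrid_le andbC -andbA; by do 2!congr andb.
Qed.

Lemma subgrid_point i j : A i j -> exists p, abscissa p = i /\ ordinate p = j.
Proof.
move=> Aij; have /andP[/andP[_ ilt] /andP[_ jle]] := A_bound Aij.
exists (Sub (Ordinal ilt, Ordinal (jle : (j < s.+1)%N)) Aij : P).
by rewrite /abscissa /ordinate SubK.
Qed.

Lemma subgrid_cover p q : covered_by p q =
  ((abscissa q == (abscissa p).+1) && (ordinate q == ordinate p)) ||
  ((abscissa q == abscissa p) && (ordinate q == (ordinate p).+1)).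
Proof.
apply/covered_byP/idP => [[]|H].
  rewrite subgrid_lt => /and3P[le1 le2 ne] cov.
  have := A_graded (in_subgrid p) (in_subgrid q) le1 le2 ne.
  have step c : (p < c)%O -> (c <= q)%O -> c = q.
    by move=> pc cq; apply/eqP; case: eqVneq => // cnq; case: (cov c); rewrite // lt_neqAle cnq.
  case/orP=> /andP[lt /subgrid_point[c [c1 c2]]].
    rewrite -(step c) ?c1 ?c2 ?eqxx// ?subgrid_lt ?subgrid_le ?c1 ?c2 ?leqnn ?leqnSn ?lt ?le2//=.
    by rewrite xpair_eqE; apply/negP => /andP[/eqP]; lia.
  rewrite -(step c) ?c1 ?c2 ?eqxx ?orbT// ?subgrid_lt ?subgrid_le ?c1 ?c2 ?leqnn ?leqnSn ?lt ?le1//=.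
  by rewrite xpair_eqE; apply/negP => /andP[_ /eqP]; lia.
split.
  rewrite subgrid_lt xpair_eqE.
  by case/orP: H => /andP[/eqP -> /eqP ->]; rewrite leqnn leqnSn /=; lia.
move=> c; rewrite !subgrid_lt !xpair_eqE.
by case/orP: H => /andP[/eqP -> /eqP ->]; lia.
Qed.

Lemma big_point (V : nmodType) (F : nat -> nat -> V) i j :
  \sum_(q : P | (abscissa q == i) && (ordinate q == j)) F (abscissa q) (ordinate q)
  = if A i j then F i j else 0.
Proof.
case: ifP => [/subgrid_point[p [p1 p2]]|Aij].
  rewrite (big_pred1 p) ?p1 ?p2// => q /=.
  by apply/andP/eqP => [[/eqP e1 /eqP e2]|->]; rewrite ?p1 ?p2//; apply: subgrid_eq; rewrite ?p1 ?p2.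
apply: big_pred0 => q; apply/negP => /andP[/eqP e1 /eqP e2].
by have := in_subgrid q; rewrite e1 e2 Aij.
Qed.

Lemma sum_covers (V : nmodType) (F : nat -> nat -> V) (Q1 Q2 : pred P) i j k l :
  (forall q, Q1 q = (abscissa q == i) && (ordinate q == j)) ->
  (forall q, Q2 q = (abscissa q == k) && (ordinate q == l)) ->
  (i, j) != (k, l) ->
  \sum_(q : P | Q1 q || Q2 q) F (abscissa q) (ordinate q)
  = (if A i j then F i j else 0) + (if A k l then F k l else 0).
Proof.
move=> Q1E Q2E ne; rewrite (bigID Q1) /= -!big_point; congr +%R.
  by apply: eq_bigl => q; rewrite -Q1E andbC; case: (Q1 q).
apply: eq_bigl => q; rewrite -Q2E; case Eq1 : (Q1 q) => /=; last by rewrite andbT.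
symmetry; apply: contra_neqF ne; rewrite Q2E.
by move: Eq1; rewrite Q1E => /andP[/eqP -> /eqP ->] /andP[/eqP -> /eqP ->].
Qed.

Definition num_at x i j : R := (label_at x i j)%:num.

Lemma num_at_gt0 x i j : 0 < num_at x i j.
Proof. by rewrite /num_at. Qed.

Lemma num_atE x p : num_at x (abscissa p) (ordinate p) = lnum x p.
Proof. by rewrite /num_at label_atE. Qed.

End GridPotentials.

(* [X] and [Y] are labelings of [A], read as functions on the grid, and [Y] is
   the image of [X] under antichain rowmotion: [D p] is both the sum of the
   weights in [Y] of the chains below [p] and the inverse of the sum of the
   weights in [X] of the chains above [p]. *)
Record potential (R : fieldType) (A : rel nat) (X Y D : nat -> nat -> R) := {
  pot_up : forall i j, A i j ->
    X i j * ((A i.+1 j)%:R / D i.+1 j + (A i j.+1)%:R / D i j.+1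
             + (~~ (A i.+1 j || A i j.+1))%:R) = (D i j)^-1;
  pot_down : forall i j, A i.+1 j.+1 ->
    Y i.+1 j.+1 * ((A i j.+1)%:R * D i j.+1 + (A i.+1 j)%:R * D i.+1 j
             + (~~ (A i j.+1 || A i.+1 j))%:R) = D i.+1 j.+1 }.

Lemma antichain_rowmotion_potential (R : realType) (r s : nat) (A : rel nat)
    (A_bound : forall i j, A i j -> (0 < i < r + s)%N && (0 < j <= s)%N)
    (A_graded : forall i j k l, A i j -> A k l -> (i <= k)%N -> (j <= l)%N ->
      (i, j) != (k, l) -> ((i < k)%N && A i.+1 j) || ((j < l)%N && A i j.+1))
    (L : linext (subgrid r s A)) (x : labeling R (subgrid r s A)) :
  exists D, (forall i j, 0 < D i j) /\
    potential A (num_at x) (num_at (antichain_rowmotion L x)) D.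
Proof.
set y := antichain_rowmotion L x.
(* Outside [A] this function takes the default value 1, so it is positive on the whole grid; the
   indicators in [potential] discard these values. *)
pose D := num_at (down_label y); exists D; split; first by move=> i j; apply: num_at_gt0.
have DE p : D (abscissa p) (ordinate p) = (up (lnum x) p)^-1.
  by rewrite /D num_atE down_labelE antichain_rowmotion_down.
have DE' p : D (abscissa p) (ordinate p) = down (lnum y) p.
  by rewrite /D num_atE down_labelE.
split=> i j Aij.
- have [p [p1 p2]] := subgrid_point A_bound Aij.
  rewrite -p1 -p2 num_atE DE invrK.
  case: (pickP (fun q => (p < q)%O)) => [q pq|pmax].
    rewrite (up_rec _ pq); congr (_ * _).
    rewrite (eq_bigl _ _ (subgrid_cover A_bound A_graded p)).
    under [RHS]eq_bigr do rewrite -[up _ _]invrK -DE.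
    rewrite (sum_covers A_bound (fun i j => (D i j)^-1) (fun q => erefl) (fun q => erefl)); last first.
      by rewrite xpair_eqE; lia.
    have -> : A (abscissa p).+1 (ordinate p) || A (abscissa p) (ordinate p).+1.
      have [c] := ex_covered_by_up pq; rewrite subgrid_cover//; have := in_subgrid c.
      by move=> Ac /orP[]/andP[/eqP <- /eqP <-]; rewrite Ac ?orbT.
    rewrite addr0; congr +%R; by case: ifP; rewrite ?mul1r ?mul0r.
  rewrite up_max => [|q]; last by rewrite pmax.
  have noA k l : (abscissa p <= k)%N -> (ordinate p <= l)%N ->
      (abscissa p, ordinate p) != (k, l) -> A k l = false.
    move=> le1 le2 ne; apply/negP => /(subgrid_point A_bound)[q [q1 q2]].
    by have := pmax q; rewrite subgrid_lt q1 q2 le1 le2 ne.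
  by rewrite !noA ?xpair_eqE//= ?mul0r ?add0r ?mulr1//; lia.
- have [p [p1 p2]] := subgrid_point A_bound Aij.
  have -> : num_at y i.+1 j.+1 = lnum y p by rewrite -p1 -p2 num_atE.
  have -> : D i.+1 j.+1 = down (lnum y) p by rewrite -p1 -p2 DE'.
  case: (pickP (fun q => (q < p)%O)) => [q pq|pmin].
    rewrite (down_rec _ pq); congr (_ * _).
    rewrite (eq_bigl _ _ (fun q => subgrid_cover A_bound A_graded q p)).
    under [RHS]eq_bigr do rewrite -DE'.
    rewrite (@sum_covers _ _ _ A_bound _ _ _ _ i j.+1 i.+1 j).
    + have -> : A i j.+1 || A i.+1 j.
        have [c] := ex_covered_by_down pq; rewrite subgrid_cover// p1 p2.
        have := in_subgrid c.
        by move=> Ac /orP[]/andP[/eqP[->] /eqP[->]]; rewrite Ac ?orbT.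
      by rewrite addr0; congr +%R; case: ifP; rewrite ?mul1r ?mul0r.
    + by move=> c; rewrite p1 p2 eqSS eq_sym [_ == ordinate c]eq_sym.
    + by move=> c; rewrite p1 p2 eqSS eq_sym [_ == ordinate c]eq_sym.
    + by rewrite xpair_eqE; lia.
  rewrite down_min => [|q]; last by rewrite pmin.
  have noA k l : (k <= abscissa p)%N -> (l <= ordinate p)%N ->
      (k, l) != (abscissa p, ordinate p) -> A k l = false.
    move=> le1 le2 ne; apply/negP => /(subgrid_point A_bound)[q [q1 q2]].
    by have := pmin q; rewrite subgrid_lt q1 q2 le1 le2 ne.
  by rewrite !noA ?p1 ?p2 ?xpair_eqE//= ?mul0r ?add0r ?mulr1//; lia.
Qed.

Lemma in_trap_bound r s i j : in_trap r s i j -> (0 < i < r + s)%N && (0 < j <= s)%N.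
Proof. by rewrite /in_trap /in_rtrap; lia. Qed.

Lemma in_trap_graded r s i j k l : in_trap r s i j -> in_trap r s k l ->
  (i <= k)%N -> (j <= l)%N -> (i, j) != (k, l) ->
  ((i < k)%N && in_trap r s i.+1 j) || ((j < l)%N && in_trap r s i j.+1).
Proof. by rewrite xpair_eqE /in_trap /in_rtrap; lia. Qed.

Lemma in_rect_bound r s i j : in_rect r s i j -> (0 < i < r + s)%N && (0 < j <= s)%N.
Proof. by rewrite /in_rect; lia. Qed.

Lemma in_rect_graded r s i j k l : in_rect r s i j -> in_rect r s k l ->
  (i <= k)%N -> (j <= l)%N -> (i, j) != (k, l) ->
  ((i < k)%N && in_rect r s i.+1 j) || ((j < l)%N && in_rect r s i j.+1).
Proof. by rewrite xpair_eqE /in_rect; lia. Qed.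

Lemma in_M_bound r s k i j : in_M r s k i j -> (0 < i < r + s)%N && (0 < j <= s)%N.
Proof. by rewrite /in_M /in_rtrap_itv /in_rtrap; lia. Qed.

Lemma in_M_graded r s m i j k l : in_M r s m i j -> in_M r s m k l ->
  (i <= k)%N -> (j <= l)%N -> (i, j) != (k, l) ->
  ((i < k)%N && in_M r s m i.+1 j) || ((j < l)%N && in_M r s m i j.+1).
Proof. by rewrite xpair_eqE /in_M /in_rtrap_itv /in_rtrap /=; lia. Qed.

(** * Flows on the trapezoid and their stream functions *)

Section TrapezoidFlows.
Variables (R : realFieldType) (r : nat).
Implicit Types (X Y Z D A : nat -> nat -> R) (f : nat -> R) (e : bool) (i j k : nat).

(* A solution of the recurrence on [in_trap r k] with sources on the antidiagonal
   [i + j = k] just below it. It vanishes at [i = r + j] if [e] is false and on the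
   wall [i = r + j - 1] if [e] is true; the sources used in the two cases have
   opposite parities. *)
Record trap_flow k X e A : Prop := TrapFlow {
  flow_step : forall i j, in_trap r k i.+1 j.+1 -> (i.+1 + e < r + j.+1)%N ->
    A i.+1 j.+1 = X i.+1 j.+1 * (A i j.+1 + A i.+1 j);
  flow_wall : forall i j, (i + e = r + j)%N -> (0 < j <= k)%N -> A i j = 0;
  flow_base : forall i, (k <= i)%N -> A i 0%N = 0;
  flow_source : forall i j, (i + j = k)%N -> odd j = e -> A i j = 0 }.

(** The two kinds use complementary halves of the sources [(k - j, j)], [1 <= j <= k]: odd [j] for
    [P] and even [j] for [Q]. *)
Definition trap_space k X f : Prop :=
  exists P Q, [/\ trap_flow k X false P, trap_flow k X true Q &
                  forall b, (b < r + k)%N -> f b = P b k + Q b k].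

(** With [phi = A / D] this is [D i j.+1 * (phi i j.+1 - phi i.+1 j.+1)], the scaled difference of
    [phi] along a horizontal edge, attached to the point below its left end. *)
Definition stream D A i j : R := A i j.+1 - A i.+1 j.+1 * D i j.+1 / D i.+1 j.+1.

Section Stream.
Variables (D : nat -> nat -> R).
Hypothesis D_gt0 : forall i j, 0 < D i j.

Lemma potential_neq0 i j : D i j != 0.
Proof. exact: lt0r_neq0. Qed.

Hint Resolve potential_neq0 : core.

Lemma potential_add_neq0 i j k l : D i j + D k l != 0.
Proof. by rewrite lt0r_neq0// addr_gt0. Qed.

Hint Resolve potential_add_neq0 : core.

(** The recurrence makes [phi i.+1 j.+1] the mean of [phi i j.+1] and [phi i.+1 j] with weights [D],
    so the scaled differences along the horizontal and the vertical edge agree. *)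
Lemma stream_left Y A i j :
  A i.+1 j.+1 = Y i.+1 j.+1 * (A i j.+1 + A i.+1 j) ->
  Y i.+1 j.+1 * (D i j.+1 + D i.+1 j) = D i.+1 j.+1 ->
  stream D A i j = D i.+1 j * (A i.+1 j.+1 / D i.+1 j.+1) - A i.+1 j.
Proof.
move=> AE YE; rewrite /stream AE.
have -> : Y i.+1 j.+1 = D i.+1 j.+1 / (D i j.+1 + D i.+1 j) by rewrite -YE mulfK.
by field; rewrite !potential_neq0 potential_add_neq0.
Qed.

(** With a single lower neighbour, [phi] is constant along the edge. *)
Lemma stream_wall Y A i j : A i.+1 j.+1 = Y i.+1 j.+1 * A i j.+1 ->
  Y i.+1 j.+1 * D i j.+1 = D i.+1 j.+1 -> stream D A i j = 0.
Proof.
move=> AE YE; rewrite /stream AE.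
have -> : Y i.+1 j.+1 = D i.+1 j.+1 / D i j.+1 by rewrite -YE mulfK.
by field; rewrite !potential_neq0.
Qed.

(** The left stream, in its vertical form, and the lower stream telescope to [D i.+1 j.+1 * (phi
    i.+1 j.+2 - phi i.+2 j.+1)]. As [phi i.+2 j.+2] is a weighted mean of the same two values, the
    new stream is a multiple of the same difference, and the factor is [X]. *)
Lemma stream_step X Y A i j :
  A i.+2 j.+2 = Y i.+2 j.+2 * (A i.+1 j.+2 + A i.+2 j.+1) ->
  Y i.+2 j.+2 * (D i.+1 j.+2 + D i.+2 j.+1) = D i.+2 j.+2 ->
  X i.+1 j.+1 * ((D i.+2 j.+1)^-1 + (D i.+1 j.+2)^-1) = (D i.+1 j.+1)^-1 ->
  stream D A i.+1 j.+1 = X i.+1 j.+1 *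
    (D i.+1 j.+1 * (A i.+1 j.+2 / D i.+1 j.+2) - A i.+1 j.+1 + stream D A i.+1 j).
Proof.
move=> AE YE XE; rewrite /stream AE.
have -> : Y i.+2 j.+2 = D i.+2 j.+2 / (D i.+1 j.+2 + D i.+2 j.+1) by rewrite -YE mulfK.
have -> : X i.+1 j.+1 =
    D i.+1 j.+2 * D i.+2 j.+1 / (D i.+1 j.+1 * (D i.+1 j.+2 + D i.+2 j.+1)).
  have ne : (D i.+2 j.+1)^-1 + (D i.+1 j.+2)^-1 != 0.
    by rewrite lt0r_neq0// addr_gt0// invr_gt0.
  by apply: (mulIf ne); rewrite XE; field; rewrite !potential_neq0 potential_add_neq0.
by field; rewrite !potential_neq0 potential_add_neq0.
Qed.

Lemma stream_step_wall X A i j :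
  A i.+2 j.+2 = 0 -> A i.+1 j.+1 = 0 ->
  X i.+1 j.+1 / D i.+1 j.+2 = (D i.+1 j.+1)^-1 ->
  stream D A i.+1 j.+1 = X i.+1 j.+1 *
    (D i.+1 j.+1 * (A i.+1 j.+2 / D i.+1 j.+2) - A i.+1 j.+1).
Proof.
move=> A0 A0' XE; rewrite /stream A0 A0' !mul0r !subr0.
have -> : X i.+1 j.+1 = D i.+1 j.+2 / D i.+1 j.+1 by rewrite -XE mulrCA divff ?mulr1.
by field; rewrite !potential_neq0.
Qed.

End Stream.

(** * The action of a single map [zeta_k] on flows *)

Section Slide.
Variables (s k : nat) (X Z D : nat -> nat -> R).
Hypotheses (k_gt0 : (0 < k)%N) (lt_ks : (k < s)%N) (le_sr : (s <= r)%N).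
Hypothesis D_gt0 : forall i j, 0 < D i j.
Hypothesis pot : potential (in_M r s k) Z
  (fun i j => if (i == k) && (j == 1%N) then 1 else X i j) D.
Hypothesis ZX : forall i j, (i < k)%N -> in_trap r k i j -> Z i j = X i j.+1.

(** The cases follow those of [zeta_k]: a shift by one row left of [M_k], where labels are only
    shifted, and the stream on [M_k], where rowmotion acts. *)
Definition slide A i j : R :=
  if (r + j <= i)%N then 0 else if (i < k)%N then A i j.+1 else stream D A i j.

Let in_ME i j : in_M r s k i j =
  [&& (k <= i)%N, (0 < j)%N, (j <= k.+1)%N & (i < r + j)%N].
Proof. by rewrite /in_M /in_rtrap_itv /in_rtrap /=; lia. Qed.

Let downE i j : in_M r s k i.+1 j.+1 -> ((k <= i) || (0 < j))%N ->
  X i.+1 j.+1 * ((in_M r s k i j.+1)%:R * D i j.+1 + (in_M r s k i.+1 j)%:R * D i.+1 j)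
  = D i.+1 j.+1.
Proof.
move=> Mij ne; have := pot_down pot Mij.
have -> : (i.+1 == k) && (j.+1 == 1%N) = false by lia.
have -> : in_M r s k i j.+1 || in_M r s k i.+1 j by move: Mij; rewrite !in_ME; lia.
by rewrite addr0.
Qed.

Let down2 i j : (k <= i)%N -> (0 < j <= k)%N -> (i.+1 < r + j)%N ->
  X i.+1 j.+1 * (D i j.+1 + D i.+1 j) = D i.+1 j.+1.
Proof.
move=> h1 h2 h3; rewrite -(@downE i j); [|by rewrite in_ME; lia|lia]. 
have -> : in_M r s k i j.+1 by rewrite in_ME; lia.
have -> : in_M r s k i.+1 j by rewrite in_ME; lia.
by rewrite !mul1r.
Qed.

Let down_wall i j : (k <= i)%N -> (j <= k)%N -> (i.+1 <= r + j)%N ->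
  (j == 0)%N || (i.+1 == r + j)%N -> X i.+1 j.+1 * D i j.+1 = D i.+1 j.+1.
Proof.
move=> h1 h2 h3 h4; rewrite -(@downE i j); [|by rewrite in_ME; lia|lia].
have -> : in_M r s k i j.+1 by rewrite in_ME; lia.
have -> : in_M r s k i.+1 j = false by rewrite in_ME; lia.
by rewrite mul1r mul0r addr0.
Qed.

Let down_left i j : i.+1 = k -> (0 < j <= k)%N -> X i.+1 j.+1 * D i.+1 j = D i.+1 j.+1.
Proof.
move=> h1 h2; rewrite -(@downE i j); [|by rewrite in_ME; lia|lia].
have -> : in_M r s k i j.+1 = false by rewrite in_ME; lia.
have -> : in_M r s k i.+1 j by rewrite in_ME; lia.
by rewrite mul1r mul0r add0r.
Qed.

Let up2 i j : (k <= i)%N -> (0 < j <= k)%N -> (i.+1 < r + j)%N ->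
  Z i j * ((D i.+1 j)^-1 + (D i j.+1)^-1) = (D i j)^-1.
Proof.
move=> h1 h2 h3; rewrite -(@pot_up _ _ _ _ _ pot i j); last by rewrite in_ME; lia.
have -> : in_M r s k i j.+1 by rewrite in_ME; lia.
have -> : in_M r s k i.+1 j by rewrite in_ME; lia.
by rewrite !mul1r addr0.
Qed.

Let up_wall i j : (k <= i)%N -> (0 < j <= k)%N -> (i.+1 = r + j)%N ->
  Z i j / D i j.+1 = (D i j)^-1.
Proof.
move=> h1 h2 h3; rewrite -(@pot_up _ _ _ _ _ pot i j); last by rewrite in_ME; lia.
have -> : in_M r s k i j.+1 by rewrite in_ME; lia.
have -> : in_M r s k i.+1 j = false by rewrite in_ME; lia.
by rewrite mul1r mul0r addr0 add0r.
Qed.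

Let up_top i : (k <= i)%N -> (i < r + k)%N -> Z i k.+1 / D i.+1 k.+1 = (D i k.+1)^-1.
Proof.
move=> h1 h2; rewrite -(@pot_up _ _ _ _ _ pot i k.+1); last by rewrite in_ME; lia.
have -> : in_M r s k i k.+2 = false by rewrite in_ME; lia.
have -> : in_M r s k i.+1 k.+1 by rewrite in_ME; lia.
by rewrite mul1r mul0r !addr0.
Qed.

Let slideE A i j : (k <= i)%N -> (i < r + j)%N -> slide A i j = stream D A i j.
Proof. by rewrite /slide => h1 h2; rewrite leqNgt h2 ltnNge h1. Qed.

Let slide_wallE A i j : (r + j <= i)%N -> slide A i j = 0.
Proof. by rewrite /slide => ->. Qed.

Let slide_leftE A i j : (i < k)%N -> slide A i j = A i j.+1.
Proof. by rewrite /slide => h; rewrite h ifF//; lia. Qed.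

(** The source [(k, 1)] has the parity excluded for this kind, and row 1 is fed from the left
    only. *)
Lemma flow_row1_eq0 A i : trap_flow k.+1 X true A -> (k <= i <= r)%N -> A i 1%N = 0.
Proof.
move=> FA; elim: i => [|i IH] h; first by lia.
have [ki|ki] : (i.+1 = k) \/ (k <= i)%N by lia.
  by apply: (flow_source FA) => //; lia.
have [ir|ir] : (i.+1 = r) \/ (i.+1 < r)%N by lia.
  by apply: (flow_wall FA); lia.
rewrite (flow_step FA) ?IH ?(flow_base FA) ?addr0 ?mulr0//; try lia.
by rewrite /in_trap /in_rtrap; lia.
Qed.

(** The wall reflects. If [A] vanishes just outside it, a wall point is fed by one neighbour only
    and the stream vanishes on the wall; if [A] vanishes on the wall, [stream_step_wall] gives the
    recurrence there with zero beyond it. The sources move down by one row, so their parity flips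
    too. *)
Lemma slide_flow e A : trap_flow k.+1 X e A -> trap_flow k Z (~~ e) (slide A).
Proof.
move=> FA; have e1 := leq_b1 e.
have base i : (k <= i)%N -> slide A i 0 = 0.
  move=> ki; have [ri|ri] := leqP r i; first by rewrite slide_wallE ?addn0.
  rewrite slideE ?addn0//.
  case: e e1 FA => _ FA.
    by rewrite /stream !(flow_row1_eq0 FA) ?mul0r ?subr0//; lia.
  apply: (stream_wall D_gt0 (Y := X)); last by apply: down_wall => //; lia.
  rewrite (flow_step FA) ?(flow_base FA) ?addr0//; try lia.
  by rewrite /in_trap /in_rtrap; lia.
split=> //.
- move=> i j; rewrite /in_trap /in_rtrap => Tij wall.
  have [ik|ki] := ltnP i.+1 k.
    rewrite !slide_leftE; try lia.
    rewrite ZX//.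
    by apply: (flow_step FA); [rewrite /in_trap /in_rtrap|]; lia.
  have left : slide A i j.+1 = D i.+1 j.+1 * (A i.+1 j.+2 / D i.+1 j.+2) - A i.+1 j.+1.
    have AE : A i.+1 j.+2 = X i.+1 j.+2 * (A i j.+2 + A i.+1 j.+1).
      by apply: (flow_step FA); [rewrite /in_trap /in_rtrap|]; lia.
    (* On the left edge of [M_k] the label [X] is a ratio of two values of [D], so the recurrence of
       [A] itself yields the form of [stream_left], although [slide] is a mere shift one column
       before. *)
    have [ik|ki'] : (i.+1 = k) \/ (k <= i)%N by lia.
      rewrite slide_leftE; last by lia.
      rewrite AE -(@down_left i j.+1)//; last by lia.
      have X0 : X i.+1 j.+2 != 0.
        have /eqP := @down_left i j.+1 ik ltac:(lia).
        by apply: contraTneq => ->; rewrite mul0r eq_sym lt0r_neq0.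
      by field; rewrite X0 lt0r_neq0.
    rewrite slideE//; last by lia.
    apply: (stream_left D_gt0 AE); apply: down2 => //; lia.
  rewrite left slideE//; last by lia.
  have [ax|ax] : (i.+2 = r + j.+1)%N \/ (i.+2 < r + j.+1)%N by lia.
    case: e e1 FA wall => _ FA wall; last by lia.
    rewrite slide_wallE ?addr0; last by lia.
    apply: (stream_step_wall D_gt0).
    + by apply: (flow_wall FA); lia.
    + by apply: (flow_wall FA); lia.
    + by apply: up_wall; lia.
  rewrite slideE//; try lia.
  apply: (stream_step D_gt0 (Y := X)).
  + by apply: (flow_step FA); [rewrite /in_trap /in_rtrap|]; lia.
  + by apply: down2; lia.
  + by apply: up2; lia.
- move=> i j; case: e e1 FA => _ FA wall jk /=.
    by rewrite slide_wallE//; lia.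
  rewrite slideE; try lia.
  apply: (stream_wall D_gt0 (Y := X)); last by apply: down_wall; lia.
  rewrite (flow_step FA); [|rewrite /in_trap /in_rtrap; lia|lia].
  by rewrite [A i.+1 j](flow_wall FA) ?addr0//; lia.
- move=> i [|j] ij oj; first by apply: base; lia.
  rewrite slide_leftE; last by lia.
  by apply: (flow_source FA); first lia; rewrite oddS oj negbK.
Qed.

(** On the top row [Z b k.+1] is [D b.+1 k.+1 / D b k.+1], which turns the stream into
    [f b - f b.+1 / Z b k.+1]. The two kinds exchange roles. *)
Lemma trap_space_slide f : trap_space k.+1 X f ->
  trap_space k Z (fun b => if (b < k)%N then f b else f b - f b.+1 / Z b k.+1).
Proof.
move=> [P [Q [FP FQ fE]]]; exists (slide Q), (slide P); split.
- exact: slide_flow FQ.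
- exact: slide_flow FP.
- move=> b br; case: ifP => bk.
    by rewrite !slide_leftE ?fE 1?addrC//; lia.
  rewrite !slideE ?fE; try lia.
  have -> : Z b k.+1 = D b.+1 k.+1 / D b k.+1.
    have /(_ (ltac:(lia)))/(_ br) E := @up_top b.
    by rewrite -E mulrCA divff ?mulr1// lt0r_neq0.
  have := potential_neq0 D_gt0 b k.+1; have := potential_neq0 D_gt0 b.+1 k.+1.
  by rewrite /stream => ne1 ne2; field; rewrite ne1 ne2.
Qed.

End Slide.

End TrapezoidFlows.

(** * Rowmotion on the trapezoid as a signed cyclic shift *)

Definition rotate (R : pzRingType) (n s : nat) (f : nat -> R) (b : nat) : R :=
  if (b.+1 < n)%N then f b.+1 else (-1) ^+ s.-1 * f 0%N.

Section TrapezoidRowmotion.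
Variables (R : realFieldType) (r s : nat) (X Y D : nat -> nat -> R).
Implicit Types (A : nat -> nat -> R) (f : nat -> R) (e : bool) (i j k : nat).
Hypotheses (s_gt0 : (0 < s)%N) (le_sr : (s <= r)%N).
Hypothesis D_gt0 : forall i j, 0 < D i j.
Hypothesis pot : potential (in_trap r s) X Y D.

Let in_TE i j : in_trap r s i j =
  [&& (0 < i)%N, (0 < j)%N, (j <= s)%N, (i < r + j)%N & (s < i + j)%N].
Proof. by rewrite /in_trap /in_rtrap /=; lia. Qed.

Let down2 i j : (0 < i)%N -> (0 < j < s)%N -> (s <= i + j)%N -> (i.+1 < r + j)%N ->
  Y i.+1 j.+1 * (D i j.+1 + D i.+1 j) = D i.+1 j.+1.
Proof.
move=> h1 h2 h3 h4; rewrite -(@pot_down _ _ _ _ _ pot i j); last by rewrite in_TE; lia.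
have -> : in_trap r s i j.+1 by rewrite in_TE; lia.
have -> : in_trap r s i.+1 j by rewrite in_TE; lia.
by rewrite !mul1r addr0.
Qed.

Let down_wall i j : (0 < i)%N -> (j < s)%N -> (s <= i + j)%N -> (i.+1 <= r + j)%N ->
  (j == 0)%N || (i.+1 == r + j)%N -> Y i.+1 j.+1 * D i j.+1 = D i.+1 j.+1.
Proof.
move=> h1 h2 h3 h4 h5; rewrite -(@pot_down _ _ _ _ _ pot i j); last by rewrite in_TE; lia.
have -> : in_trap r s i j.+1 by rewrite in_TE; lia.
have -> : in_trap r s i.+1 j = false by rewrite in_TE; lia.
by rewrite mul1r mul0r !addr0.
Qed.

Let down_min i j : (i + j = s.-1)%N -> Y i.+1 j.+1 = D i.+1 j.+1.
Proof.
move=> ij; rewrite -(@pot_down _ _ _ _ _ pot i j); last by rewrite in_TE; lia.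
have -> : in_trap r s i j.+1 = false by rewrite in_TE; lia.
have -> : in_trap r s i.+1 j = false by rewrite in_TE; lia.
by rewrite !mul0r !add0r mulr1.
Qed.

Let up2 i j : in_trap r s i j -> (j < s)%N -> (i.+1 < r + j)%N ->
  X i j * ((D i.+1 j)^-1 + (D i j.+1)^-1) = (D i j)^-1.
Proof.
move=> h1 h2 h3; rewrite -(@pot_up _ _ _ _ _ pot i j)//.
have -> : in_trap r s i j.+1 by move: h1; rewrite !in_TE; lia.
have -> : in_trap r s i.+1 j by move: h1; rewrite !in_TE; lia.
by rewrite !mul1r addr0.
Qed.

Let up_wall i j : in_trap r s i j -> (j < s)%N -> (i.+1 = r + j)%N ->
  X i j / D i j.+1 = (D i j)^-1.
Proof.
move=> h1 h2 h3; rewrite -(@pot_up _ _ _ _ _ pot i j)//.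
have -> : in_trap r s i j.+1 by move: h1; rewrite !in_TE; lia.
have -> : in_trap r s i.+1 j = false by move: h1; rewrite !in_TE; lia.
by rewrite mul1r mul0r addr0 add0r.
Qed.

Let up_top i : (0 < i)%N -> (i.+1 < r + s)%N -> X i s = D i.+1 s / D i s.
Proof.
move=> h1 h2; have : in_trap r s i s by rewrite in_TE; lia.
move/(@pot_up _ _ _ _ _ pot i s).
have -> : in_trap r s i.+1 s by rewrite in_TE; lia.
have -> : in_trap r s i s.+1 = false by rewrite in_TE; lia.
by rewrite mul1r mul0r !addr0 => <-; rewrite mulrCA divff ?mulr1// lt0r_neq0.
Qed.

Let up_max i : (i.+1 = r + s)%N -> X i s = (D i s)^-1.
Proof.
move=> h1; have : in_trap r s i s by rewrite in_TE; lia.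
move/(@pot_up _ _ _ _ _ pot i s).
have -> : in_trap r s i.+1 s = false by rewrite in_TE; lia.
have -> : in_trap r s i s.+1 = false by rewrite in_TE; lia.
by rewrite !mul0r !add0r mulr1.
Qed.

(** A stream on row [s] would need row [s + 1]; there the shifted flow takes its place. The minus
    sign below makes the recurrence along the top row hold. *)
Definition unrow A i j : R :=
  if j == s then if (i.+1 < r + s)%N then A i.+1 s else 0
  else if (r + j <= i)%N then 0 else - stream D A i j.

Let unrowE A i j : (j < s)%N -> (i < r + j)%N -> unrow A i j = - stream D A i j.
Proof. by rewrite /unrow => h1 h2; rewrite [(r + j <= i)%N]leqNgt h2 ltn_eqF. Qed.

Let unrow_wallE A i j : (j < s)%N -> (r + j <= i)%N -> unrow A i j = 0.
Proof. by rewrite /unrow => h1 ->; rewrite ltn_eqF. Qed.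

Let unrow_topE A i : (i.+1 < r + s)%N -> unrow A i s = A i.+1 s.
Proof. by rewrite /unrow eqxx => ->. Qed.

Let unrow_maxE A i : (r + s <= i.+1)%N -> unrow A i s = 0.
Proof. by rewrite /unrow eqxx leqNgt => /negPf ->. Qed.

Let flow_row1_eq0' A i : trap_flow r s Y true A -> (s <= i <= r)%N -> A i 1%N = 0.
Proof.
move=> FA; elim: i => [|i IH] h; first by lia.
have [ir|ir] : (i.+1 = r) \/ (i.+1 < r)%N by lia.
  by apply: (flow_wall FA); lia.
rewrite (flow_step FA) ?in_TE ?(flow_base FA) ?addr0; try lia.
have [si|si] : (i.+1 = s) \/ (s <= i)%N by lia.
  by rewrite (flow_source FA) ?mulr0//; lia.
by rewrite IH ?mulr0//; lia.
Qed.

Let min_flow e A i j : trap_flow r s Y e A -> (i + j.+1 = s)%N -> odd j.+1 = ~~ e ->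
  (i.+1 + e < r + j.+1)%N ->  A i.+1 j.+1 = D i.+1 j.+1 * A i j.+1.
Proof.
move=> FA ij oj wall; rewrite (flow_step FA) ?in_TE; try lia.
by rewrite (flow_source FA (i := i.+1)) ?addr0 ?down_min//; lia.
Qed.

Let min_flow' e A i j : trap_flow r s Y e A -> (i.+1 + j = s)%N -> odd j = ~~ e ->
  (i.+1 + e < r + j.+1)%N ->  A i.+1 j.+1 = D i.+1 j.+1 * A i.+1 j.
Proof.
move=> FA ij oj wall; rewrite (flow_step FA) ?in_TE; try lia.
by rewrite (flow_source FA (i := i)) ?add0r ?down_min//; lia.
Qed.

Lemma unrow_base e A i : trap_flow r s Y e A -> (s <= i)%N -> unrow A i 0 = 0.
Proof.
move=> FA si; have [ri|ri] := leqP r i; first by rewrite unrow_wallE ?addn0.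
rewrite unrowE ?addn0//; apply/eqP; rewrite oppr_eq0; apply/eqP.
case: e FA => FA.
  by rewrite /stream !(flow_row1_eq0' FA) ?mul0r ?subr0//; lia.
apply: (stream_wall D_gt0 (Y := Y)); last by apply: down_wall; lia.
by rewrite (flow_step FA) ?in_TE ?(flow_base FA) ?addr0//; lia.
Qed.

Lemma unrow_step e A i j : trap_flow r s Y e A -> in_trap r s i.+1 j.+1 ->
  (i.+1 + ~~ e < r + j.+1)%N ->
  unrow A i.+1 j.+1 = X i.+1 j.+1 * (unrow A i j.+1 + unrow A i.+1 j).
Proof.
move=> FA; have e1 := leq_b1 e; rewrite in_TE => Tij wall.
have [js|js] : (j.+1 = s) \/ (j.+1 < s)%N by lia.
  rewrite {1 3}js.
  have [top|top] : (i.+2 = r + s)%N \/ (i.+2 < r + s)%N by lia.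
    rewrite unrow_maxE ?top// js unrow_topE; last by lia.
    rewrite unrow_wallE; try lia.
    case: e e1 FA wall => _ FA wall; last by lia.
    by rewrite (flow_wall FA) ?addr0 ?mulr0//; lia.
  rewrite unrow_topE// js unrow_topE; last by lia.
  rewrite unrowE; try lia.
  rewrite up_top// /stream js.
  by field; rewrite !lt0r_neq0.
have left : unrow A i j.+1 = - (D i.+1 j.+1 * (A i.+1 j.+2 / D i.+1 j.+2) - A i.+1 j.+1).
  rewrite unrowE//; last by lia.
  congr (- _); apply: (stream_left D_gt0 (Y := Y)); last by apply: down2; lia.
  by apply: (flow_step FA); rewrite ?in_TE; lia.
rewrite left unrowE//; last by lia.
have [ax|ax] : (i.+2 = r + j.+1)%N \/ (i.+2 < r + j.+1)%N by lia.
  case: e e1 FA wall => _ FA wall; last by lia.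
  rewrite unrow_wallE ?addr0 ?mulrN; try lia.
  congr (- _); apply: (stream_step_wall D_gt0).
  + by apply: (flow_wall FA); lia.
  + by apply: (flow_wall FA); lia.
  + by apply: up_wall; rewrite ?in_TE; lia.
rewrite unrowE; try lia.
rewrite -opprD mulrN; congr (- _); apply: (stream_step D_gt0 (Y := Y)).
+ by apply: (flow_step FA); rewrite ?in_TE; lia.
+ by apply: down2; lia.
+ by apply: up2; rewrite ?in_TE; lia.
Qed.

Lemma unrow_wall e A i j : trap_flow r s Y e A ->
  (i + ~~ e = r + j)%N -> (0 < j <= s)%N -> unrow A i j = 0.
Proof.
move=> FA wall js.
have [{}js|{}js] : (j = s) \/ (0 < j < s)%N by lia.
  by rewrite js unrow_maxE//; move: wall; case: (e); lia.
case: e FA wall => FA wall; first by rewrite unrow_wallE//; lia.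
rewrite unrowE; try lia.
apply/eqP; rewrite oppr_eq0; apply/eqP.
apply: (stream_wall D_gt0 (Y := Y)); last by apply: down_wall; lia.
rewrite (flow_step FA) ?in_TE; try lia.
by rewrite [A i.+1 j](flow_wall FA) ?addr0//; lia.
Qed.

(** The neighbouring sources have the wrong parity, so around the source [(i, j)] the quotient
    [A / D] equals [A i j] at the three points [(i + 1, j)], [(i, j + 1)], [(i + 1, j + 1)], and its
    differences vanish. For [j = 0] this is [unrow_base]. *)
Lemma unrow_source e A i j : trap_flow r s Y e A ->
  (i + j = s)%N -> (j < s)%N -> odd j = ~~ e -> unrow A i j = 0.
Proof.
move=> FA; have e1 := leq_b1 e; case: j => [|j] ij js oj.
  by apply: (unrow_base FA); lia.
case: i ij => [|i] ij; first by lia.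
have e0 : e -> (0 < j)%N by move=> he; move: oj; rewrite he; case: (j).
have {}e0 : (e <= j)%N by case: (e) e0 => // ->.
rewrite unrowE; try lia.
rewrite (stream_left D_gt0 (Y := Y)); last first.
- by apply: down2; lia.
- by apply: (flow_step FA); rewrite ?in_TE; lia.
have E1 : A i.+2 j.+1 = D i.+2 j.+1 * A i.+1 j.+1 by apply: (min_flow FA) => //; lia.
have E2 : A i.+1 j.+2 = D i.+1 j.+2 * A i.+1 j.+1 by apply: (min_flow' FA) => //; lia.
have E3 : A i.+2 j.+2 = D i.+2 j.+2 * A i.+1 j.+1.
  rewrite (flow_step FA) ?in_TE; try lia.
  rewrite E1 E2 -mulrDl mulrA; congr (_ * _); apply: down2; lia.
by rewrite E3 E1 mulrAC divff ?lt0r_neq0// mul1r subrr oppr0.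
Qed.

(* The flow out of the top left source runs along the top row only; at the
   maximum of the trapezoid it is [0] if the wall contains the maximum. *)
Definition top_row_flow e i j : R :=
  if j == s then if (i.+1 < r + s)%N then D i.+1 s else (~~ e && (i.+1 == r + s)%N)%:R
  else 0.

(** The shift on the top row leaves [A 1 s = D 1 s * A 0 s] at the source [(0, s)] when [A] may be
    nonzero there. The other kind excludes this source, and the multiple of [top_row_flow] removes
    the value. *)
Lemma unrow_flow e A (c : R) : trap_flow r s Y e A -> (odd s = ~~ e -> c = - A 0%N s) ->
  trap_flow r s X (~~ e) (fun i j => unrow A i j + c * top_row_flow (~~ e) i j).
Proof.
move=> FA cE; split.
- move=> i j Tij wall; rewrite (unrow_step FA)//.
  rewrite [RHS](_ : _ = X i.+1 j.+1 * (unrow A i j.+1 + unrow A i.+1 j) +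
    c * (X i.+1 j.+1 * (top_row_flow (~~ e) i j.+1 + top_row_flow (~~ e) i.+1 j))).
    congr (_ + c * _); rewrite /top_row_flow; move: Tij; rewrite in_TE => Tij.
    case: eqVneq => [js|js]; last by rewrite [j == s]ltn_eqF; [rewrite addr0 mulr0|lia].
    rewrite [j == s]ltn_eqF; last by lia.
    have -> : (i.+1 < r + s)%N by lia.
    rewrite addr0 js; case: ifP => top; first by rewrite up_top// divfK// lt0r_neq0.
    have top' : (i.+2 = r + s)%N by lia.
    rewrite up_max// mulVf ?lt0r_neq0// top' eqxx andbT.
    suff -> : ~~ ~~ e by []. 
    by move: wall; case: (e) => //=; lia.
  by ring.
- move=> i j wall js; rewrite (unrow_wall FA)// add0r /top_row_flow.
  case: eqVneq => [jE|_]; last by rewrite mulr0.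
  rewrite ifF; last by move: wall; rewrite jE; case: (e) => /=; lia.
  by move: wall; rewrite jE; case: (e) => /= wall; rewrite ?mulr0// gtn_eqF ?mulr0//; lia.
- move=> i si; rewrite (unrow_base FA)// /top_row_flow.
  by rewrite ltn_eqF// mulr0 addr0.
- move=> i j ij oj; have [js|js] : (j = s) \/ (j < s)%N by lia.
    have -> : i = 0%N by lia.
    rewrite js in oj *; rewrite /top_row_flow eqxx.
    have lt1 : (1 < r + s)%N by lia.
    rewrite lt1 unrow_topE// cE//.
    have e0 : (e < s)%N by move: oj; case: (e) => //=; case: (s) s_gt0 => [|[]].
    have := min_flow FA (i := 0%N) (j := s.-1).
    rewrite prednK// => -> //; last by lia.
    by rewrite mulNr [A _ _ * _]mulrC subrr.
  rewrite (unrow_source FA)// /top_row_flow ltn_eqF// mulr0 addr0//.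
Qed.

Lemma trap_space_rowmotion f :
  trap_space r s Y f -> trap_space r s X (rotate (r + s) s f).
Proof.
(* By parity one of [P 0 s], [Q 0 s] is zero, so [c] is [f 0] up to the sign [(-1) ^+ s.-1]. The two
   corrections cancel along the top row except at the maximum, where only the first is nonzero: this
   is the value that wraps around. *)
move=> [P [Q [FP FQ fE]]]; pose c := P 0%N s - Q 0%N s.
exists (fun i j => unrow Q i j + c * top_row_flow false i j).
exists (fun i j => unrow P i j + - c * top_row_flow true i j); split.
- apply: (unrow_flow FQ) => os; rewrite /c (flow_source FP) ?sub0r//.
- apply: (unrow_flow FP) => os; rewrite /c (flow_source FQ) ?subr0//.
move=> b br; rewrite /rotate /top_row_flow eqxx; case: ifP => top.
  by rewrite !unrow_topE// fE//; ring.
have top' : b.+1 = (r + s)%N by lia.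
rewrite !unrow_maxE ?top'//= eqxx /= fE ?addn_gt0 ?s_gt0 ?orbT// /c.
rewrite -signr_odd (_ : odd s.-1 = ~~ odd s); last by lia.
case os: (odd s).
  by rewrite (flow_source FQ (i := 0%N))//; ring.
by rewrite (flow_source FP (i := 0%N))//; ring.
Qed.

End TrapezoidRowmotion.

(** * Rowmotion on the rectangle, and recovery of a labeling from its space *)

Section RectangleSpace.
Variables (R : realFieldType) (r s : nat).
Implicit Types (V X Y Z D A : nat -> nat -> R) (f g : nat -> R) (i j k : nat).

(* The sign makes [rotate] the same cyclic shift as on the trapezoid. *)
Definition rect_space V f : Prop := exists A,
  [/\ forall i j, (i < r)%N -> (j < s)%N ->
        A i.+1 j.+1 = V i.+1 j.+1 * (A i j.+1 + A i.+1 j),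
      forall i, A i 0%N = 0,
      forall j, (j < s)%N -> f j = (-1) ^+ (s.-1 - j) * A 0%N j.+1 &
      forall i, (i <= r)%N -> f (i + s.-1)%N = A i s].

Section Rowmotion.
Variables (X Y D : nat -> nat -> R).
Hypotheses (r_gt0 : (0 < r)%N) (s_gt0 : (0 < s)%N).
Hypothesis D_gt0 : forall i j, 0 < D i j.
Hypothesis pot : potential (in_rect r s) X Y D.

Let D_neq0 i j : D i j != 0.
Proof. exact: lt0r_neq0. Qed.

Let rectE i j : in_rect r s i.+1 j.+1 = (i < r)%N && (j < s)%N.
Proof. by []. Qed.

Let rect0l j : in_rect r s 0 j = false.
Proof. by []. Qed.

Let rect0r i : in_rect r s i 0 = false.
Proof. by rewrite /in_rect andbF. Qed.

Let down2 i j : (i.+1 < r)%N -> (j.+1 < s)%N ->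
  Y i.+2 j.+2 = D i.+2 j.+2 / (D i.+1 j.+2 + D i.+2 j.+1).
Proof.
move=> h1 h2; have : in_rect r s i.+2 j.+2 by rewrite rectE h1 h2.
move/(@pot_down _ _ _ _ _ pot i.+1 j.+1); rewrite !rectE h1 h2 (ltnW h1) (ltnW h2) => <- //.
by rewrite !mul1r addr0 mulfK// lt0r_neq0// addr_gt0.
Qed.

Let down_left j : (j.+1 < s)%N -> Y 1%N j.+2 = D 1%N j.+2 / D 1%N j.+1.
Proof.
move=> h2; have : in_rect r s 1 j.+2 by rewrite rectE h2 r_gt0.
move/(@pot_down _ _ _ _ _ pot 0 j.+1); rewrite !rectE rect0l r_gt0 (ltnW h2) => <- //.
by rewrite mul1r mul0r add0r addr0 mulfK.
Qed.

Let down_row1 i : (i.+1 < r)%N -> Y i.+2 1%N = D i.+2 1%N / D i.+1 1%N.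
Proof.
move=> h1; have : in_rect r s i.+2 1 by rewrite rectE h1 s_gt0.
move/(@pot_down _ _ _ _ _ pot i.+1 0); rewrite !rectE rect0r s_gt0 (ltnW h1) => <- //.
by rewrite mul1r mul0r !addr0 mulfK.
Qed.

Let down_min : Y 1%N 1%N = D 1%N 1%N.
Proof.
have : in_rect r s 1 1 by rewrite rectE r_gt0 s_gt0.
move/(@pot_down _ _ _ _ _ pot 0 0); rewrite rect0l rect0r /= => <-.
by rewrite !mul0r !add0r mulr1.
Qed.

Let up2 i j : (i.+1 < r)%N -> (j.+1 < s)%N ->
  X i.+1 j.+1 * ((D i.+2 j.+1)^-1 + (D i.+1 j.+2)^-1) = (D i.+1 j.+1)^-1.
Proof.
move=> h1 h2; have : in_rect r s i.+1 j.+1 by rewrite rectE (ltnW h1) ltnW.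
move/(@pot_up _ _ _ _ _ pot i.+1 j.+1); rewrite !rectE h1 h2 (ltnW h1) (ltnW h2) => <- //.
by rewrite !mul1r addr0.
Qed.

Let up_top i : (i.+1 < r)%N -> X i.+1 s = D i.+2 s / D i.+1 s.
Proof.
case: s s_gt0 rectE pot => // s' _ E pot' h1.
have : in_rect r s'.+1 i.+1 s'.+1 by rewrite E (ltnW h1) /=.
move/(@pot_up _ _ _ _ _ pot' i.+1 s'.+1); rewrite !E h1 (ltnW h1) leqnn ltnn /=.
by rewrite mul1r mul0r !addr0 => <-; rewrite mulrCA divff ?mulr1.
Qed.

Let up_right j : (j.+1 < s)%N -> X r j.+1 = D r j.+2 / D r j.+1.
Proof.
case: r r_gt0 rectE pot => // r' _ E pot' h1.
have : in_rect r'.+1 s r'.+1 j.+1 by rewrite E (ltnW h1) leqnn.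
move/(@pot_up _ _ _ _ _ pot' r'.+1 j.+1); rewrite !E h1 (ltnW h1) leqnn ltnn /=.
by rewrite mul1r mul0r addr0 add0r => <-; rewrite mulrCA divff ?mulr1.
Qed.

Let up_max : X r s = (D r s)^-1.
Proof.
case: r r_gt0 rectE pot => // r' _; case: s s_gt0 => // s' _ E pot'.
have : in_rect r'.+1 s'.+1 r'.+1 s'.+1 by rewrite E !leqnn.
move/(@pot_up _ _ _ _ _ pot' r'.+1 s'.+1); rewrite !E !ltnn !andbF /=.
by rewrite !mul0r !add0r mulr1.
Qed.

Variables (f : nat -> R) (B : nat -> nat -> R).
Hypothesis B_step : forall i j, (i < r)%N -> (j < s)%N ->
  B i.+1 j.+1 = X i.+1 j.+1 * (B i j.+1 + B i.+1 j).
Hypothesis B_base : forall i, B i 0%N = 0.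

(** This integrates [B] back: it is [phi i.+1 j] for the flow [D * phi] whose stream, in its
    vertical form, is [- B]. *)
Definition column_sum i j : R := \sum_(j <= m < s.+1) B i m / D i.+1 m.

Lemma column_sumE i j : (j <= s)%N -> column_sum i j = B i j / D i.+1 j + column_sum i j.+1.
Proof. by move=> js; rewrite /column_sum big_ltn. Qed.

Lemma column_sum_top i : column_sum i s = B i s / D i.+1 s.
Proof. by rewrite column_sumE// /column_sum big_geq// addr0. Qed.

(** On each unit square the recurrence of [B] and the relation between [X] and [D] say that [B] is
    also the horizontal difference; the sums of two adjacent columns are compared by descending from
    the top row. *)
Lemma column_sum_diff i j : (i.+1 < r)%N -> (j < s)%N ->
  column_sum i.+1 j.+1 = column_sum i j.+1 + B i.+1 j / D i.+1 j.+1.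
Proof.
move=> ir js; have [t tE] : exists t, (j + t).+1 = s by exists (s - j.+1)%N; lia.
elim: t j js tE => [|t IH] j js tE.
  have {}tE : j.+1 = s by lia.
  rewrite tE !column_sum_top -tE (B_step (ltnW ir))// tE up_top//.
  by field; rewrite !D_neq0.
rewrite !(column_sumE _ js) IH; try lia.
have jS : (j.+1 < s)%N by lia.
rewrite [in B i.+1 j.+1 / D i.+1 j.+2](B_step (ltnW ir) js).
rewrite [in B i.+1 j.+1 / D i.+2 j.+1](B_step (ltnW ir) js).
have ne : (D i.+2 j.+1)^-1 + (D i.+1 j.+2)^-1 != 0.
  by rewrite lt0r_neq0// addr_gt0// invr_gt0.
have ne' : D i.+2 j.+1 + D i.+1 j.+2 != 0 by rewrite lt0r_neq0// addr_gt0.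
have -> : X i.+1 j.+1 = D i.+2 j.+1 * D i.+1 j.+2 /
    (D i.+1 j.+1 * (D i.+2 j.+1 + D i.+1 j.+2)).
  by apply: (mulIf ne); rewrite up2//; field; rewrite !D_neq0 ne'.
by field; rewrite !D_neq0 ne'.
Qed.

Lemma column_sum_last j : (j < s)%N ->
  column_sum r.-1 j.+1 = B r s - B r j / D r j.+1.
Proof.
move=> js; have [t tE] : exists t, (j + t).+1 = s by exists (s - j.+1)%N; lia.
have BE m : (m < s)%N -> B r m.+1 = X r m.+1 * (B r.-1 m.+1 + B r m).
  by move=> ms; have := @B_step r.-1 m; rewrite prednK//; apply; rewrite ?prednK.
elim: t j js tE => [|t IH] j js tE.
  have {}tE : j.+1 = s by lia.
  rewrite tE !column_sum_top -tE BE// tE up_max prednK//.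
  by field; rewrite !D_neq0.
rewrite !(column_sumE _ js) IH; try lia.
have jS : (j.+1 < s)%N by lia.
rewrite [B r j.+1]BE// up_right// prednK//.
by field; rewrite !D_neq0.
Qed.

(** As [B] vanishes on row 0, the full sum does not depend on the column, and its value is read off
    in the last one. *)
Lemma column_sum_bottom i : (i < r)%N -> column_sum i 1 = B r s.
Proof.
move=> ir; have [t tE] : exists t, (i + t).+1 = r by exists (r - i.+1)%N; lia.
elim: t i ir tE => [|t IH] i ir tE.
  have -> : i = r.-1 by lia.
  by rewrite column_sum_last// B_base mul0r subr0.
have := IH i.+1; rewrite column_sum_diff ?B_base ?mul0r ?addr0; try lia.
by apply; lia.
Qed.

(** On the left boundary the old values move up by one with a sign, and the end [B r s] of the top
    row re-enters at the bottom. *)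
Definition unrotate_flow i j : R :=
  match j, i with
  | 0, _ => 0
  | j'.+1, 0 => if j' == 0%N then B r s else - B 0%N j'
  | j'.+1, i'.+1 => D i'.+1 j'.+1 * column_sum i' j'.+1
  end.

Lemma unrotate_flow_step i j : (i < r)%N -> (j < s)%N ->
  unrotate_flow i.+1 j.+1 = Y i.+1 j.+1 * (unrotate_flow i j.+1 + unrotate_flow i.+1 j).
Proof.
case: i j => [|i] [|j] ir js /=.
- by rewrite addr0 column_sum_bottom// down_min.
- rewrite down_left// (column_sumE _ (ltnW js)).
  by field; rewrite !D_neq0.
- rewrite addr0 down_row1// !column_sum_bottom//; last exact: ltnW.
  by field; rewrite !D_neq0.
- rewrite down2// (column_sumE _ (ltnW js)) column_sum_diff//.
  have ne' : D i.+1 j.+2 + D i.+2 j.+1 != 0 by rewrite lt0r_neq0// addr_gt0.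
  by field; rewrite !D_neq0 ne'.
Qed.

End Rowmotion.

Lemma rect_space_rowmotion X Y D f : (0 < r)%N -> (0 < s)%N ->
  (forall i j, 0 < D i j) -> potential (in_rect r s) X Y D ->
  rect_space X (rotate (r + s) s f) -> rect_space Y f.
Proof.
move=> r0 s0 D0 pot [B [B1 B2 B3 B4]].
have topE i : (i < r)%N -> f (i.+1 + s.-1)%N = B i s.
  move=> ir; rewrite -B4 ?(ltnW ir)// /rotate ifT ?addSn//; lia.
have f0E : f 0%N = (-1) ^+ s.-1 * B r s.
  by rewrite -B4// /rotate ifF ?signrMK//; lia.
have fSE j : (j.+1 < s)%N -> f j.+1 = (-1) ^+ (s.-1 - j) * B 0%N j.+1.
  by move=> js; rewrite -B3 ?(ltnW js)// /rotate ifT//; lia.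
exists (unrotate_flow D B); split.
- by move=> i j; apply: (unrotate_flow_step r0 s0 D0 pot B1 B2).
- by move=> [].
- case=> [|j] js /=; first by rewrite f0E subn0.
  rewrite fSE// mulrN -mulNr; congr (_ * _).
  by rewrite (_ : s.-1 - j = (s.-1 - j.+1).+1)%N ?exprS ?mulN1r//; lia.
- case=> [|i] ir; last first.
    have E j : (0 < j)%N -> unrotate_flow D B i.+1 j = D i.+1 j * column_sum D B i j.
      by case: j.
    by rewrite E// topE// column_sum_top mulrC divfK// lt0r_neq0.
  (* The corner index [s - 1] belongs to both the left boundary and the top row; for [s = 1] it is
     the index 0, where the wrapped value re-enters. *)
  rewrite add0n; have [s1|s1] : (s = 1)%N \/ (1 < s)%N by lia.
    have -> : unrotate_flow D B 0 s = B r s.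
      by rewrite [X in unrotate_flow _ _ _ X]s1.
    by move: f0E; rewrite (_ : s.-1 = 0%N) ?expr0 ?mul1r//; lia.
  have E j : (0 < j)%N -> unrotate_flow D B 0 j.+1 = - B 0%N j by case: j.
  have lt2 : (s.-2.+1 < s)%N by lia.
  have lt1 : (0 < s.-1)%N by lia.
  have := fSE _ lt2; have := E _ lt1.
  rewrite (_ : s.-2.+1 = s.-1)%N; last by lia.
  rewrite (_ : s.-1.+1 = s)%N; last by lia.
  rewrite (_ : s.-1 - s.-2 = 1)%N; last by lia.
  by move=> -> ->; rewrite expr1 mulN1r.
Qed.

Lemma rect_flow_eq0 V A m : (forall i j, (i < r)%N -> (j < s)%N ->
    A i.+1 j.+1 = V i.+1 j.+1 * (A i j.+1 + A i.+1 j)) ->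
  (forall i, A i 0%N = 0) -> (m <= s)%N -> (forall j, (j <= m)%N -> A 0%N j = 0) ->
  forall i j, (i <= r)%N -> (j <= m)%N -> A i j = 0.
Proof.
move=> A1 A2 ms A0; elim=> [|i IH] j ir jm; first exact: A0.
elim: j jm => [|j IHj] jm; first exact: A2.
by rewrite A1 ?IH ?IHj ?addr0 ?mulr0//; lia.
Qed.

(** Rows are treated from the top, [t] counting those above. For the function whose first nonzero
    index is [m], the flow vanishes up to row [m] and nowhere on row [m + 1], so the labels of that
    row are quotients of consecutive flow values. These values are common to [V] and [V'], since the
    rows above have equal labels and the flow can be computed downwards from the top row. *)
Lemma rect_space_inj V V' :
  (forall i j, 0 < V i j) -> (forall i j, 0 < V' i j) ->
  (forall m, (m < s)%N -> exists f, [/\ forall b, (b < m)%N -> f b = 0, f m != 0,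
     rect_space V f & rect_space V' f]) ->
  forall i j, in_rect r s i j -> V i j = V' i j.
Proof.
move=> V0 V0' fam [|i] [|j]; rewrite ?/in_rect ?andbF//= => /andP[ir js].
have [t tE] : exists t, (j + t).+1 = s by exists (s - j.+1)%N; lia.
elim/ltn_ind: t i j ir js tE => t IH i m ir ms tE.
have {}IH k j : (k < r)%N -> (m < j < s)%N -> V k.+1 j.+1 = V' k.+1 j.+1.
  by move=> kr mj; apply: (IH (s - j.+1)%N); lia.
have [f [f0 fm [A [A1 A2 A3 A4]] [A' [A1' A2' A3' A4']]]] := fam m ms.
have bnd : forall W C, (forall i j, (i < r)%N -> (j < s)%N ->
    C i.+1 j.+1 = W i.+1 j.+1 * (C i j.+1 + C i.+1 j)) -> (forall i, C i 0%N = 0) ->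
    (forall j, (j < s)%N -> f j = (-1) ^+ (s.-1 - j) * C 0%N j.+1) ->
    forall i, (i <= r)%N -> C i m = 0.
  move=> W C C1 C2 C3 k kr; apply: (rect_flow_eq0 C1 C2 (ltnW ms)) => // -[|j] jm //.
  have /eqP := C3 j ltac:(lia); rewrite f0// eq_sym mulf_eq0 signr_eq0 /=.
  by move/eqP.
have A0 := bnd _ _ A1 A2 A3; have A0' := bnd _ _ A1' A2' A3'.
have eqA k j : (k <= r)%N -> (m < j <= s)%N -> A k j = A' k j.
  move=> kr mj; have [u uE] : exists u, (j + u)%N = s by exists (s - j)%N; lia.
  elim: u k j kr mj uE => [|u IHu] k j kr mj uE.
    by rewrite (_ : j = s) -?A4 -?A4'//; lia.
  case: k kr => [|k] kr.
    case: j mj uE => [|j] mj uE; first by lia.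
    apply: (@mulrI _ ((-1) ^+ (s.-1 - j))); first by rewrite unitfE signr_eq0.
    by rewrite -A3 -?A3'//; lia.
  have js : (j < s)%N by lia.
  have := A1 k j kr js; have := A1' k j kr js.
  rewrite !(IHu k.+1 j.+1) ?(IHu k j.+1) ?IH; try lia.
  move=> -> /mulfI => /(_ (lt0r_neq0 (V0' _ _))) /addrI; exact: esym.
have nz k : (k <= r)%N -> A k m.+1 != 0.
  elim: k => [|k IHk] kr.
    by apply: contraNneq fm => A00; rewrite A3// A00 mulr0.
  by rewrite A1// A0// addr0 mulf_neq0 ?IHk ?(ltnW kr)// lt0r_neq0.
have E := A1 i m ir ms; have E' := A1' i m ir ms.
apply: (mulIf (nz i (ltnW ir))).
rewrite A0 // addr0 in E; rewrite A0' // addr0 in E'.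
by rewrite -E eqA ?E' ?eqA//; lia.
Qed.

End RectangleSpace.

(** * Spaces attached to the intermediate posets *)

Section IntermediateSpace.
Variables (R : realFieldType) (r s : nat).
Implicit Types (V X Y Z D A : nat -> nat -> R) (f g : nat -> R) (i j k : nat).

(** The rows of [I_k] above [k] form a rectangle, whose recurrence is undone one row at a time, up
    to sign: [g j] is the trace on row [j], and [b + k - j] converts the index [b] into an abscissa.
    What remains at level [k] must lie in the space of the trapezoid. *)
Definition inter_space k Z f : Prop := exists g : nat -> nat -> R,
  [/\ forall b, (b < r + s)%N -> g s b = f b,
      forall j b, (k <= j < s)%N -> (b < r + j)%N -> g j b =
        if (b < j)%N then g j.+1 b else g j.+1 b - g j.+1 b.+1 / Z (b + k - j)%N j.+1 &
      trap_space r k Z (g k)].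

Lemma trap_space_ext k X X' f f' : trap_space r k X f ->
  (forall i j, in_trap r k i j -> X i j = X' i j) ->
  (forall b, (b < r + k)%N -> f b = f' b) -> trap_space r k X' f'.
Proof.
move=> [P [Q [FP FQ fE]]] XX' ff'; exists P, Q.
split; last by move=> b br; rewrite -ff' ?fE.
- split; [|exact: flow_wall FP|exact: flow_base FP|exact: flow_source FP].
  by move=> i j Tij wall; rewrite (flow_step FP)// XX'.
- split; [|exact: flow_wall FQ|exact: flow_base FQ|exact: flow_source FQ].
  by move=> i j Tij wall; rewrite (flow_step FQ)// XX'.
Qed.

Lemma trap_flow_lin k X e A A' (c : R) : trap_flow r k X e A -> trap_flow r k X e A' ->
  trap_flow r k X e (fun i j => c * A i j + A' i j).
Proof.
move=> F F'; split=> [i j Tij wall|i j wall jk|i ik|i j ij oj].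
- by rewrite (flow_step F)// (flow_step F')//; ring.
- by rewrite (flow_wall F)// (flow_wall F')// mulr0 addr0.
- by rewrite (flow_base F)// (flow_base F')// mulr0 addr0.
- by rewrite (flow_source F)// (flow_source F')// mulr0 addr0.
Qed.

Lemma trap_space_lin k X f g (c : R) : trap_space r k X f -> trap_space r k X g ->
  trap_space r k X (fun b => c * f b + g b).
Proof.
move=> [P [Q [FP FQ fE]]] [P' [Q' [FP' FQ' gE]]].
exists (fun i j => c * P i j + P' i j), (fun i j => c * Q i j + Q' i j).
split; [exact: trap_flow_lin|exact: trap_flow_lin|].
by move=> b br; rewrite fE// gE//; ring.
Qed.

Lemma trap_space_inter X f : trap_space r s X f -> inter_space s X f.
Proof. by exists (fun=> f); split=> // j b; rewrite ltnNge andbN. Qed.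

(** For [k = 1] the traces [g j], with alternating signs, form a flow on the rectangle. On row 1
    only the first kind survives, which gives the recurrence there. *)
Lemma inter_space_rect Z f : (0 < s)%N -> (forall i j, 0 < Z i j) ->
  inter_space 1 Z f -> rect_space r s Z f.
Proof.
move=> s0 Z0 [g [gs gj [P [Q [FP FQ gE]]]]].
have g1 b : (b < r)%N -> g 1%N b.+1 = Z b.+1 1%N * g 1%N b.
  have Q0 l : (l <= r)%N -> Q l 1%N = 0.
    elim: l => [|l IH] lr; first by apply: (flow_source FQ).
    have [->|lr'] : (l.+1 = r) \/ (l.+1 < r)%N by lia.
      by apply: (flow_wall FQ); lia.
    rewrite (flow_step FQ) ?IH ?(flow_base FQ) ?addr0 ?mulr0//; try lia.
    by rewrite /in_trap /in_rtrap; lia.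
  move=> br; rewrite !gE ?Q0 ?addr0; try lia.
  rewrite (flow_step FP) ?(flow_base FP) ?addr0//; try lia.
  by rewrite /in_trap /in_rtrap; lia.
exists (fun i j => if j is j'.+1 then (-1) ^+ (s - j) * g j (i + j')%N else 0); split=> //.
- move=> i [|j] ir js; first by rewrite addr0 !addn0 g1//; ring.
  have jE : (0 < j.+1 < s)%N by rewrite js.
  have := gj j.+1 (i.+1 + j)%N jE ltac:(lia).
  rewrite ifF; last by lia.
  rewrite (_ : i.+1 + j + 1 - j.+1 = i.+1)%N; last by lia.
  move=> ->; rewrite (_ : s - j.+1 = (s - j.+2).+1)%N; last by lia.
  rewrite addSn addnS exprS.
  by field; rewrite lt0r_neq0.
- move=> j js; rewrite add0n (_ : s.-1 - j = s - j.+1)%N; last by lia.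
  rewrite signrMK; have [t tE] : exists t, (j.+1 + t = s)%N by exists (s - j.+1)%N; lia.
  have H u : (j.+1 <= u)%N -> (u <= s)%N -> g u j = f j.
    move=> ju us; have [w wE] : exists w, (u + w = s)%N by exists (s - u)%N; lia.
    elim: w u ju us wE => [|w IH] u ju us wE; first by rewrite (_ : u = s) ?gs//; lia.
    by rewrite gj; [rewrite ju IH//; lia| lia| lia].
  by rewrite H.
- move=> i ir; rewrite -gs; last by lia.
  by case: (s) s0 => // s' _; rewrite subnn expr0 mul1r.
Qed.

(** Row [k + 1] is peeled off by [trap_space_slide]. The higher rows of labels move one column to
    the left, and the offset [b + k - j] absorbs this, so their traces stay the same. *)
Lemma inter_space_slide k X Z Z' D f :
  (0 < k)%N -> (k < s)%N -> (s <= r)%N -> (forall i j, 0 < D i j) ->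
  potential (in_M r s k) Z' (fun i j => if (i == k) && (j == 1%N) then 1 else X i j) D ->
  (forall i j, in_M r s k i j -> (i < r + k)%N -> Z i j = Z' i j) ->
  (forall i j, (i < k)%N -> in_trap r k i j -> Z i j = X i j.+1) ->
  (forall i j, (k <= i < r + k)%N -> (k.+1 < j <= s)%N -> Z i j = X i.+1 j) ->
  inter_space k.+1 X f -> inter_space k Z f.
Proof.
move=> k0 ks sr D0 pot ZZ' ZX ZX' [g [gs gj gk]].
pose h b := if (b < k)%N then g k.+1 b else g k.+1 b - g k.+1 b.+1 / Z b k.+1.
exists (fun j => if j == k then h else g j); split.
- by move=> b br; rewrite gtn_eqF// gs.
- move=> j b kj br; rewrite [j.+1 == k]gtn_eqF; last by lia.
  have [->|jk] := eqVneq; first by rewrite addnK.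
  rewrite gj; try lia.
  case: ltnP => // jb.
  have E : (b + k - j).+1 = (b + k.+1 - j)%N by lia.
  by rewrite ZX' ?E//; lia.
rewrite eqxx.
(* [trap_space_slide] needs one function for both the labels on [M_k] and those to its left. *)
pose Z'' i j := if (k <= i)%N then Z' i j else Z i j.
have pot' : potential (in_M r s k) Z''
    (fun i j => if (i == k) && (j == 1%N) then 1 else X i j) D.
  split=> i j Mij; last exact: (pot_down pot).
  rewrite /Z'' ifT; first exact: (pot_up pot).
  by move: Mij; rewrite /in_M /in_rtrap_itv /= ; lia.
have ZX'' i j : (i < k)%N -> in_trap r k i j -> Z'' i j = X i j.+1.
  by move=> ik Tij; rewrite /Z'' leqNgt ik /= ZX.
apply: (trap_space_ext (trap_space_slide k0 ks sr D0 pot' ZX'' gk)).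
- move=> i j Tij; rewrite /Z''; case: leqP => // ki; rewrite ZZ'//; move: Tij;
    rewrite /in_M /in_rtrap_itv /in_trap /in_rtrap /=; lia.
- move=> b br; rewrite /h; case: ltnP => // kb; rewrite /Z'' kb ZZ'//.
  by rewrite /in_M /in_rtrap_itv /in_trap /in_rtrap /=; lia.
Qed.

End IntermediateSpace.

(** * Flows from a single source *)

Section EchelonFamily.
Variables (R : realFieldType) (r s : nat).
Implicit Types (X A : nat -> nat -> R) (f g : nat -> R) (i j k : nat).

Lemma trap_flow0 X e : trap_flow r s X e (fun _ _ => 0).
Proof. by split=> // i j _ _; rewrite addr0 mulr0. Qed.

Section PathSums.
Variables (ok : nat -> nat -> bool) (X : nat -> nat -> R) (m0 j0 : nat).

(** Total weight of the lattice paths out of [(m0, j0)]; the nested [fix] makes the recursion on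
    both coordinates structural. *)
Fixpoint path_sum (i : nat) : nat -> R :=
  fix column (j : nat) : R :=
    match i, j with
    | i'.+1, j'.+1 => if ok i'.+1 j'.+1 then X i'.+1 j'.+1 * (path_sum i' j'.+1 + column j')
                      else ((i == m0) && (j == j0))%:R
    | _, _ => ((i == m0) && (j == j0))%:R
    end.

Lemma path_sum_step i j : ok i.+1 j.+1 ->
  path_sum i.+1 j.+1 = X i.+1 j.+1 * (path_sum i j.+1 + path_sum i.+1 j).
Proof. by move=> /= ->. Qed.

Hypothesis ok_pos : forall i j, ok i j -> (0 < i)%N && (0 < j)%N.

Lemma path_sum_src i j : ~~ ok i j -> path_sum i j = ((i == m0) && (j == j0))%:R.
Proof. by case: i j => [|i] [|j] //= /negPf ->. Qed.

Lemma path_sum_ge0 i j : (forall i j, 0 < X i j) -> 0 <= path_sum i j.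
Proof.
move=> X0; elim: i j => [|i IH] j; first by case: j => [|j] /=; apply: ler0n.
elim: j => [|j IHj]; first exact: ler0n.
have [okij|/path_sum_src ->] := boolP (ok i.+1 j.+1); last exact: ler0n.
by rewrite path_sum_step// mulr_ge0 ?addr_ge0// ltW.
Qed.

Lemma path_sum_eq0 i j : (i < m0)%N -> path_sum i j = 0.
Proof.
elim: i j => [|i IH] j im.
  have nok : ~~ ok 0 j by apply/negP => /ok_pos.
  by rewrite path_sum_src// ltn_eqF.
elim: j => [|j IHj].
  have nok : ~~ ok i.+1 0 by apply/negP => /ok_pos; rewrite andbF.
  by rewrite path_sum_src// ltn_eqF.
have [okij|/path_sum_src ->] := boolP (ok i.+1 j.+1); last by rewrite ltn_eqF.
by rewrite path_sum_step// IHj IH ?addr0 ?mulr0//; lia.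
Qed.

End PathSums.

(** The flow out of the single source [(m, s - m)] is used: paths never move left, so it vanishes at
    abscissas below [m], and it is positive up the column of abscissa [m]. *)
Lemma trap_space_echelon X m : (s <= r)%N -> (forall i j, 0 < X i j) -> (m < s)%N ->
  exists f, [/\ trap_space r s X f, forall b, (b < m)%N -> f b = 0, f m != 0 &
                m.+1 = s -> 0 < f (r + s).-1].
Proof.
move=> sr X0 ms; pose e := ~~ odd (s - m).
pose ok i j := in_trap r s i j && (i + e < r + j)%N.
have okP i j : ok i j -> (0 < i)%N && (0 < j)%N.
  by rewrite /ok /in_trap /in_rtrap; lia.
pose A := path_sum ok X m (s - m).
have A0 i j : 0 <= A i j by apply: path_sum_ge0.
(* For [m.+1 = s] the source has ordinate 1, so [e] is false and the wall does not cut off the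
   maximum. *)
have e1 : (e + (m.+1 == s) <= 1)%N.
  rewrite /e; case: eqVneq => [<-|_]; last by rewrite addn0 leq_b1.
  by rewrite subSnn.
have FA : trap_flow r s X e A.
  have src i j : ~~ ok i j -> ~~ ((i == m) && (j == s - m)%N) -> A i j = 0.
    by move=> h h'; rewrite /A path_sum_src// (negPf h').
  split.
  - by move=> i j Tij wall; apply: path_sum_step; rewrite /ok Tij wall.
  - move=> i j wall js; apply: src; rewrite /ok; first by rewrite wall ltnn andbF.
    by apply/negP => /andP[/eqP iE /eqP jE]; lia.
  - move=> i si; apply: src; first by apply/negP => /okP; rewrite andbF.
    by apply/negP => /andP[/eqP iE /eqP jE]; lia.
  - move=> i j ij oj; apply: src.
      by rewrite /ok /in_trap; lia.
    by apply/negP => /andP[/eqP iE /eqP jE]; move: oj; rewrite jE /e; case: odd.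
have Amm : A m (s - m)%N = 1.
  rewrite /A path_sum_src ?eqxx//; by rewrite /ok /in_trap; lia.
have Acol t : (t <= m)%N -> 0 < A m (s - m + t)%N.
  elim: t => [|t IH] tm; first by rewrite addn0 Amm.
  case: m ms tm @e @ok okP @A A0 e1 FA Amm IH => // m ms tm e ok okP A A0 e1 FA Amm IH.
  rewrite addnS /A path_sum_step; last by rewrite /ok /in_trap /in_rtrap; lia.
  by rewrite mulr_gt0// ltr_wpDl//; apply: IH; lia.
exists (A^~ s); split.
- case: (e) FA => FA.
    exists (fun _ _ => 0), A; split; [exact: trap_flow0|exact: FA|].
    by move=> b _; rewrite add0r.
  exists A, (fun _ _ => 0); split; [exact: FA|exact: trap_flow0|].
  by move=> b _; rewrite addr0.
- by move=> b bm; apply: path_sum_eq0.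
- by rewrite lt0r_neq0//; have := Acol m (leqnn m); rewrite subnK// ltnW.
move=> mE; have e0 : nat_of_bool e = 0%N by move: e1; rewrite mE eqxx; lia.
have Arow t : (t <= r)%N -> 0 < A (m + t)%N s.
  elim: t => [|t IH] tr.
    by rewrite addn0; have := Acol m (leqnn m); rewrite subnK// ltnW.
  have s0 : (0 < s)%N by lia.
  rewrite addnS; have -> : A (m + t).+1 s = A (m + t).+1 s.-1.+1 by rewrite prednK.
  rewrite /A path_sum_step; last by rewrite /ok /in_trap /in_rtrap e0; lia.
  rewrite mulr_gt0// ltr_pwDl//.
  by have := IH ltac:(lia); rewrite /A prednK.
by rewrite (_ : (r + s).-1 = m + r)%N; [apply: Arow|lia].
Qed.

(** Nothing lies above the maximum of the trapezoid, so its label affects the flow at that point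
    only. *)
Lemma trap_space_scale X X' f (c : R) :
  (forall i j, (i.+1 == r + s)%N && (j == s) = false -> X' i j = X i j) ->
  X' (r + s).-1 s = c * X (r + s).-1 s ->
  trap_space r s X f ->
  trap_space r s X' (fun b => if (b.+1 == r + s)%N then c * f b else f b).
Proof.
move=> X'E X'c [P [Q [FP FQ fE]]].
pose sc (A : nat -> nat -> R) i j :=
  if (i.+1 == r + s)%N && (j == s) then c * A i j else A i j.
have scF e A : trap_flow r s X e A -> trap_flow r s X' e (sc A).
  move=> FA; split.
  - move=> i j Tij wall; rewrite /sc.
    have -> : (i.+1 == r + s)%N && (j.+1 == s) = false.
      by apply/negP => /andP[/eqP E1 /eqP E2]; move: Tij; rewrite /in_trap /in_rtrap; lia.
    have -> : (i.+2 == r + s)%N && (j == s) = false.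
      by apply/negP => /andP[/eqP E1 /eqP E2]; move: Tij; rewrite /in_trap /in_rtrap; lia.
    rewrite (flow_step FA)//.
    case: ifP => [/andP[/eqP iE /eqP jE]|/X'E -> //].
    have E : i.+1 = (r + s).-1 by lia.
    by rewrite E jE X'c mulrA.
  - by move=> i j wall js; rewrite /sc (flow_wall FA)// mulr0 if_same.
  - by move=> i si; rewrite /sc (flow_base FA)// mulr0 if_same.
  - by move=> i j ij oj; rewrite /sc (flow_source FA)// mulr0 if_same.
exists (sc P), (sc Q); split; [exact: scF|exact: scF|].
move=> b br; rewrite /sc eqxx andbT fE//; case: ifP => // _; exact: mulrDr.
Qed.

End EchelonFamily.

Lemma iter_rotate (R : pzRingType) n s (f : nat -> R) m b : (m <= n)%N -> (b < n)%N ->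
  iter m (rotate n s) f b =
    if (b + m < n)%N then f (b + m)%N else (-1) ^+ s.-1 * f (b + m - n)%N.
Proof.
elim: m b => [|m IH] b mn bn /=; first by rewrite addn0 bn.
rewrite /rotate; case: ltnP => [b1|b1].
  by rewrite IH ?addSnnS//; lia.
have bE : b.+1 = n by lia.
rewrite IH ?add0n; try lia.
rewrite (_ : m < n)%N; last by lia.
rewrite ifF; last by lia.
by congr (_ * f _); lia.
Qed.

(** * The maps [zeta_k] and [zeta] on labelings *)

Section Labels.
Variables (R : realType) (r s : nat).
Implicit Types (A B : rel nat) (i j k : nat).

Lemma num_at_point A (x : labeling R (subgrid r s A)) i j :
  (forall i j, A i j -> (0 < i < r + s)%N && (0 < j <= s)%N) -> A i j ->
  exists p, [/\ abscissa p = i, ordinate p = j & num_at x i j = lnum x p].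
Proof.
by move=> bA /(subgrid_point bA)[p [<- <-]]; exists p; rewrite num_atE.
Qed.

Lemma num_at_out A (x : labeling R (subgrid r s A)) i j : ~~ A i j -> num_at x i j = 1.
Proof.
move=> nA; rewrite /num_at /label_at; case: pickP => // p /andP[/eqP pi /eqP pj].
by case/negP: nA; rewrite -pi -pj; apply: in_subgrid.
Qed.

Lemma num_at_inj A (x y : labeling R (subgrid r s A)) :
  (forall i j, A i j -> num_at x i j = num_at y i j) -> x = y.
Proof.
move=> xy; apply: lnum_inj => p; rewrite -!num_atE; apply: xy; exact: in_subgrid.
Qed.

Lemma num_at_relabel A B (x : labeling R (subgrid r s A)) i j :
  (forall i j, B i j -> (0 < i < r + s)%N && (0 < j <= s)%N) -> B i j ->
  num_at (relabel B x) i j = num_at x i j.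
Proof.
move=> bB /(num_at_point (relabel B x) bB)[p [pi pj ->]].
by rewrite /lnum ffunE /num_at -pi -pj.
Qed.

Lemma in_inter_bound k i j : (0 < k <= s)%N -> in_inter r s k i j ->
  (0 < i < r + s)%N && (0 < j <= s)%N.
Proof. by rewrite /in_inter /in_rtrap_itv /in_trap /in_rtrap /=; lia. Qed.

Lemma rect_space_ext (V V' : nat -> nat -> R) f : rect_space r s V f ->
  (forall i j, in_rect r s i j -> V i j = V' i j) -> rect_space r s V' f.
Proof.
move=> [A [A1 A2 A3 A4]] VV'; exists A; split=> // i j ir js.
by rewrite A1// VV'// /in_rect ir js.
Qed.

Variable L : forall k, linext (Mposet r s k).

Section Step.
Variable k : nat.
Hypotheses (k_gt0 : (0 < k)%N) (lt_ks : (k < s)%N) (le_sr : (s <= r)%N).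
Implicit Type x : labeling R (intermediate r s k.+1).

Lemma num_at_xbar x i j : in_M r s k i j ->
  num_at (xbar x) i j = if (i == k) && (j == 1%N) then 1 else num_at x i j.
Proof.
move=> Mij; have [p [pi pj ->]] := num_at_point (xbar x) (@in_M_bound r s k) Mij.
by rewrite /lnum ffunE -/(abscissa p) -/(ordinate p) pi pj; case: ifP.
Qed.

Lemma num_at_zeta_step x i j : in_inter r s k i j ->
  num_at (zeta_step L x) i j =
    if in_M r s k i j then num_at (antichain_rowmotion_inv (L k) (xbar x)) i j
    else if (k.+1 < j)%N then num_at x i.+1 j else num_at x i j.+1.
Proof.
move=> Iij; have bI := @in_inter_bound k; have ks : (0 < k <= s)%N by lia.
have [p [pi pj ->]] := num_at_point (zeta_step L x) (fun i j => bI i j ks) Iij.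
rewrite /lnum ffunE /= -/(abscissa p) -/(ordinate p) pi pj.
by case: ifP => // _; case: ifP.
Qed.

Lemma zeta_step_potential x : exists D, (forall i j, 0 < D i j) /\
  potential (in_M r s k) (num_at (antichain_rowmotion_inv (L k) (xbar x)))
    (fun i j => if (i == k) && (j == 1%N) then 1 else num_at x i j) D.
Proof.
have [D [D0 pot]] := antichain_rowmotion_potential (@in_M_bound r s k)
  (@in_M_graded r s k) (L k) (antichain_rowmotion_inv (L k) (xbar x)).
exists D; split=> //; split=> i j Mij; first exact: (pot_up pot).
by rewrite -num_at_xbar// -(pot_down pot Mij) antichain_rowmotion_invK.
Qed.

Lemma inter_space_zeta_step x f : inter_space r s k.+1 (num_at x) f ->
  inter_space r s k (num_at (zeta_step L x)) f.
Proof.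
have [D [D0 pot]] := zeta_step_potential x.
apply: (inter_space_slide k_gt0 lt_ks le_sr D0 pot).
- move=> i j Mij ik; rewrite num_at_zeta_step ?Mij//; move: Mij.
  by rewrite /in_M /in_inter /in_rtrap_itv /in_trap /in_rtrap /=; lia.
- move=> i j ik Tij; rewrite num_at_zeta_step; last by rewrite /in_inter Tij.
  by rewrite ifF ?ifF//; move: Tij;
    rewrite /in_M /in_rtrap_itv /in_trap /in_rtrap /=; lia.
- move=> i j ik jk; rewrite num_at_zeta_step.
    by rewrite ifF ?ifT//; rewrite /in_M /in_rtrap_itv /in_rtrap /=; lia.
  by rewrite /in_inter /in_rtrap_itv /in_trap /in_rtrap /=; lia.
Qed.

(** The label of [Z] at the maximum [(r + k, k + 1)] of [M_k], which [zeta_k] discards, only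
    rescales [D], as [D] is computed downwards from there. The scale is recovered at the minimum
    [(k, 1)], where [D] equals [Y]; for [zeta_k] this is the value 1 put into [xbar]. *)
Lemma slide_potential_unique (Z Z' Y Y' D D' : nat -> nat -> R) :
  (forall i j, 0 < D i j) -> (forall i j, 0 < D' i j) ->
  potential (in_M r s k) Z Y D -> potential (in_M r s k) Z' Y' D' ->
  (forall i j, in_M r s k i j -> (i < r + k)%N -> Z i j = Z' i j) ->
  Y k 1%N = Y' k 1%N ->
  forall i j, in_M r s k i j -> D i j = D' i j.
Proof.
move=> D0 D0' pot pot' ZZ' YY'.
have ME i j : in_M r s k i j =
    [&& (k <= i)%N, (0 < j)%N, (j <= k.+1)%N & (i < r + j)%N].
  by rewrite /in_M /in_rtrap_itv /in_rtrap /=; lia.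
pose c := D' (r + k)%N k.+1 / D (r + k)%N k.+1.
have c0 : 0 < c by rewrite divr_gt0.
have scale i j : in_M r s k i j -> D' i j = c * D i j.
  have [t tE] : exists t, (r + k - i + (k.+1 - j) = t)%N by exists (r + k - i + (k.+1 - j))%N.
  elim/ltn_ind: t i j tE => t IH i j tE Mij.
  have [iE|ik] : (i = (r + k)%N) \/ (i < r + k)%N by move: Mij; rewrite ME; lia.
    have jE : j = k.+1 by move: Mij; rewrite ME; lia.
    by rewrite iE jE /c divfK// lt0r_neq0.
  apply: invr_inj; rewrite invfM -(pot_up pot' Mij) -(pot_up pot Mij) ZZ'//.
  have -> : in_M r s k i.+1 j || in_M r s k i j.+1 by move: Mij; rewrite !ME; lia.
  rewrite mulrCA; congr (_ * _); rewrite !addr0 mulrDr; congr (_ + _).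
  - case M1: (in_M r s k i.+1 j); last by rewrite !mul0r mulr0.
    rewrite !mul1r -invfM -(IH _ _ _ _ erefl)//; move: M1; rewrite ME; lia.
  - case M1: (in_M r s k i j.+1); last by rewrite !mul0r mulr0.
    rewrite !mul1r -invfM -(IH _ _ _ _ erefl)//; move: M1; rewrite ME; lia.
have Mk1 : in_M r s k k 1 by rewrite ME; lia.
have DY : D k 1%N = Y k 1%N /\ D' k 1%N = Y' k 1%N.
  have := @pot_down _ _ _ _ _ pot k.-1 0; have := @pot_down _ _ _ _ _ pot' k.-1 0.
  rewrite prednK// => /(_ Mk1) <- /(_ Mk1) <-.
  have -> : in_M r s k k.-1 1 = false by rewrite ME; lia.
  have -> : in_M r s k k 0 = false by rewrite ME; lia.
  by rewrite !mul0r !add0r !mulr1.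
have c1 : c = 1.
  have := scale _ _ Mk1; rewrite DY.2 DY.1 YY' => /esym/eqP.
  rewrite -{2}[Y' _ _]mul1r => /eqP /mulIf; apply.
  by rewrite -DY.2 lt0r_neq0.
by move=> i j /scale ->; rewrite c1 mul1r.
Qed.

Lemma zeta_step_inj : injective (@zeta_step R r s L k).
Proof.
move=> x x' xx'; have ks : (0 < k <= s)%N by lia.
have zE i j : num_at (zeta_step L x) i j = num_at (zeta_step L x') i j by rewrite xx'.
have [D [D0 pot]] := zeta_step_potential x.
have [D' [D0' pot']] := zeta_step_potential x'.
have DD' : forall i j, in_M r s k i j -> D i j = D' i j.
  apply: (slide_potential_unique D0 D0' pot pot') => //; last by rewrite !eqxx.
  move=> i j Mij ik; have := zE i j; rewrite !num_at_zeta_step ?Mij//; move: Mij;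
    by rewrite /in_M /in_inter /in_rtrap_itv /in_trap /in_rtrap /=; lia.
apply: num_at_inj => i j Iij.
have [Mij|nMij] := boolP (in_M r s k i j).
  case: i j Iij Mij => [|i] [|j] Iij Mij;
    try by move: Mij; rewrite /in_M /in_rtrap_itv /in_rtrap /=; lia.
  have := pot_down pot Mij; have := pot_down pot' Mij.
  rewrite (_ : (i.+1 == k) && (j.+1 == 1%N) = false); last first.
    by move: Iij; rewrite /in_inter /in_rtrap_itv /in_trap /in_rtrap /=; lia.
  set S' := (X in _ * X = _) => E'; set S := (X in _ * X = _) => E.
  have SS' : S = S'.
    rewrite /S /S'; congr (_ + _ + _).
      by case M1: (in_M r s k i j.+1); rewrite ?mul0r// DD'.
    by case M1: (in_M r s k i.+1 j); rewrite ?mul0r// DD'.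
  have S0 : S' != 0.
    by apply: contraTneq (D0' i.+1 j.+1) => S0; rewrite -E' S0 mulr0 ltxx.
  by apply: (mulIf S0); rewrite E' -SS' E DD'.
have [ik|ki] := ltnP i k.
  case: j Iij nMij => [|j] Iij nMij.
    by move: Iij; rewrite /in_inter /in_rtrap_itv /in_trap /in_rtrap /=; lia.
  have := zE i j; rewrite !num_at_zeta_step; last 2 first.
  - by move: Iij; rewrite /in_inter /in_rtrap_itv /in_trap /in_rtrap /=; lia.
  - by move: Iij; rewrite /in_inter /in_rtrap_itv /in_trap /in_rtrap /=; lia.
  have -> : in_M r s k i j = false by rewrite /in_M /in_rtrap_itv /=; lia.
  have -> // : (k.+1 < j)%N = false.
  by move: Iij; rewrite /in_inter /in_rtrap_itv /in_trap /in_rtrap /=; lia.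
case: i Iij nMij ki => [|i] Iij nMij ki.
  by move: Iij; rewrite /in_inter /in_rtrap_itv /in_trap /in_rtrap /=; lia.
have kj : (k.+1 < j)%N.
  by move: Iij nMij; rewrite /in_M /in_inter /in_rtrap_itv /in_trap /in_rtrap /=; lia.
have Ii : in_inter r s k i j.
  by move: Iij; rewrite /in_inter /in_rtrap_itv /in_trap /in_rtrap /=; lia.
have := zE i j; rewrite !num_at_zeta_step// kj.
by have -> : in_M r s k i j = false by rewrite /in_M /in_rtrap_itv /=; lia.
Qed.

End Step.

Hypotheses (s_gt0 : (0 < s)%N) (le_sr : (s <= r)%N).

Lemma inter_space_zeta_comp m (x : labeling R (intermediate r s m.+1)) f :
  (m < s)%N -> inter_space r s m.+1 (num_at x) f ->
  inter_space r s 1 (num_at (zeta_comp L x)) f.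
Proof.
elim: m x => [|m IH] x ms //= xf.
by apply: IH; [lia|apply: inter_space_zeta_step].
Qed.

Lemma zeta_comp_inj m : (m < s)%N -> injective (@zeta_comp R r s L m).
Proof.
elim: m => [|m IH] ms x y //= xy.
apply: (@zeta_step_inj m.+1) => //; apply: IH => //; lia.
Qed.

Lemma trap_space_zeta (x : labeling R (trapezoid r s)) f :
  trap_space r s (num_at x) f -> rect_space r s (num_at (zeta L x)) f.
Proof.
move=> xf.
have sP (X : nat -> nat -> R) : trap_space r s X f -> inter_space r s s.-1.+1 X f.
  by rewrite prednK//; apply: trap_space_inter.
set y := relabel (in_inter r s s.-1.+1) x.
have yx i j : in_trap r s i j -> num_at x i j = num_at y i j.
  move=> Tij; rewrite num_at_relabel//; last by rewrite /in_inter prednK// Tij.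
  by move=> k l; apply: in_inter_bound; lia.
have /sP yf := trap_space_ext xf yx (fun _ _ => erefl).
have /inter_space_zeta_comp := yf => /(_ ltac:(lia)) zf.
apply: (rect_space_ext (inter_space_rect s_gt0 _ zf)); first exact: num_at_gt0.
by move=> i j Rij; rewrite num_at_relabel//; apply: in_rect_bound.
Qed.

Lemma zeta_inj : injective (@zeta R r s L).
Proof.
move=> x x' xx'.
have comp_eq : zeta_comp L (relabel (in_inter r s s.-1.+1) x) =
    zeta_comp L (relabel (in_inter r s s.-1.+1) x').
  apply: num_at_inj => i j; rewrite in_inter1//; last by lia.
  move=> Rij; have : num_at (zeta L x) i j = num_at (zeta L x') i j by rewrite xx'.
  by rewrite !num_at_relabel//; apply: in_rect_bound.
apply: num_at_inj => i j Tij.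
have bI k l : in_inter r s s.-1.+1 k l -> (0 < k < r + s)%N && (0 < l <= s)%N.
  by apply: in_inter_bound; lia.
have Iij : in_inter r s s.-1.+1 i j by rewrite /in_inter prednK// Tij.
have lt_s : (s.-1 < s)%N by lia.
have := zeta_comp_inj lt_s comp_eq.
by move=> /(congr1 (fun y => num_at y i j)); rewrite !num_at_relabel.
Qed.

End Labels.

(** * Equivariance and the exact order *)

Section Equivariance.
Variables (R : realType) (r s : nat).
Hypotheses (s_gt0 : (0 < s)%N) (le_sr : (s <= r)%N).
Variables (LT : linext (trapezoid r s)) (LR : linext (rectangle r s)).
Variable LM : forall k, linext (Mposet r s k).
Implicit Types (x : labeling R (trapezoid r s)) (v : labeling R (rectangle r s)).

Local Notation rhoT := (@antichain_rowmotion R _ (trapezoid r s) LT).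
Local Notation rhoR := (@antichain_rowmotion R _ (rectangle r s) LR).

Lemma trap_space_rhoT x f :
  trap_space r s (num_at (rhoT x)) f -> trap_space r s (num_at x) (rotate (r + s) s f).
Proof.
have [D [D0 pot]] := antichain_rowmotion_potential (@in_trap_bound r s)
  (@in_trap_graded r s) LT x.
exact: (trap_space_rowmotion s_gt0 le_sr D0 pot).
Qed.

Lemma rect_space_rhoR v f :
  rect_space r s (num_at v) (rotate (r + s) s f) -> rect_space r s (num_at (rhoR v)) f.
Proof.
have [D [D0 pot]] := antichain_rowmotion_potential (@in_rect_bound r s)
  (@in_rect_graded r s) LR v.
by apply: (rect_space_rowmotion _ s_gt0 D0 pot); lia.
Qed.

Lemma rect_label_eq x v v' :
  (forall f, trap_space r s (num_at x) f -> rect_space r s (num_at v) f) ->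
  (forall f, trap_space r s (num_at x) f -> rect_space r s (num_at v') f) -> v = v'.
Proof.
move=> xv xv'; apply: num_at_inj => i j Rij.
apply: (rect_space_inj (num_at_gt0 v) (num_at_gt0 v') _ Rij) => m ms.
have [f [xf f0 fm _]] := trap_space_echelon le_sr (num_at_gt0 x) ms.
by exists f; split; [| |exact: xv|exact: xv'].
Qed.

Lemma zeta_equivariant x : zeta LM (rhoT x) = rhoR (zeta LM x).
Proof.
apply: (@rect_label_eq (rhoT x)) => f xf; first exact: trap_space_zeta.
by apply: rect_space_rhoR; apply: trap_space_zeta => //; apply: trap_space_rhoT.
Qed.

Lemma trap_space_iter m x f : trap_space r s (num_at (iter m rhoT x)) f ->
  trap_space r s (num_at x) (iter m (rotate (r + s) s) f).
Proof.
elim: m f => // m IH f /trap_space_rhoT /IH; by rewrite -iterSr.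
Qed.

Lemma rhoT_periodic x : iter (r + s)%N rhoT x = x.
Proof.
apply: (zeta_inj s_gt0 le_sr (L := LM)).
apply: (@rect_label_eq (iter (r + s) rhoT x)) => f xf; first exact: trap_space_zeta.
apply: trap_space_zeta => //; have {}xf := trap_space_iter xf.
(* The zero function turns the linear combination below into a scaling by the sign left after
   [r + s] shifts. *)
have z0 : trap_space r s (num_at x) (fun _ => 0).
  by exists (fun _ _ => 0), (fun _ _ => 0); split; [exact: trap_flow0|exact: trap_flow0|
    rewrite addr0].
apply: (trap_space_ext (trap_space_lin ((-1) ^+ s.-1) xf z0)) => // b br.
by rewrite iter_rotate// ifF ?addnK ?signrMK ?addr0//; lia.
Qed.

(** If the [m]-th iterate were the identity, the spaces of two labelings differing only at the
    maximum would both be stable under [m] shifts. They differ by a scaling of the last coordinate,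
    which does not commute with these shifts. *)
Lemma rhoT_iter_neq_id m : (0 < m <= r)%N -> ~ (iter m rhoT =1 id).
Proof.
move=> mr idm; pose n := (r + s)%N.
pose one : {posnum R} := PosNum (@ltr01 R).
pose two : {posnum R} := PosNum (@ltr0Sn R 1).
pose x : labeling R (trapezoid r s) := [ffun=> one].
pose x2 : labeling R (trapezoid r s) :=
  [ffun p => if ((abscissa p).+1 == n) && (ordinate p == s) then two else one].
have xE i j : num_at x i j = 1.
  have [Tij|nTij] := boolP (in_trap r s i j); last by rewrite num_at_out.
  by have [p [_ _ ->]] := num_at_point x (@in_trap_bound r s) Tij; rewrite /lnum ffunE.
have x2E i j : num_at x2 i j = if (i.+1 == n) && (j == s) then 2 else 1.
  have [Tij|nTij] := boolP (in_trap r s i j).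
    have [p [pi pj ->]] := num_at_point x2 (@in_trap_bound r s) Tij.
    by rewrite /lnum ffunE pi pj; case: ifP.
  rewrite num_at_out// ifF//; apply: contraNF nTij => /andP[/eqP iE /eqP ->].
  by move: iE; rewrite /in_trap /in_rtrap /n; lia.
have nE : n.-1.+1 = n by rewrite prednK//; rewrite /n; lia.
have inv (y : labeling R (trapezoid r s)) f : trap_space r s (num_at y) f ->
    trap_space r s (num_at y) (iter m (rotate n s) f).
  by move=> yf; apply: trap_space_iter; rewrite idm.
have [f [xf _ _ /(_ (prednK s_gt0)) f0]] :=
  trap_space_echelon le_sr (num_at_gt0 x) (ltac:(lia) : (s.-1 < s)%N).
pose sc (c : R) g b := if b.+1 == n then c * g b else g b.
(* Doubling the last coordinate leads from the space of [x] to that of [x2]; after shifting there,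
   halving it leads back. *)
have xf2 : trap_space r s (num_at x2) (sc 2 f).
  apply: trap_space_scale xf => [i j ij|]; rewrite ?xE ?x2E; first by rewrite ij.
  by rewrite nE !eqxx mulr1.
have xf1 : trap_space r s (num_at x) (sc 2^-1 (iter m (rotate n s) (sc 2 f))).
  apply: trap_space_scale (inv _ _ xf2) => [i j ij|]; rewrite ?xE ?x2E; first by rewrite ij.
  by rewrite nE !eqxx mulVf// pnatr_eq0.
(* [chi] is supported on the last index and on its image under the shift, which is
   too small for a nonzero element of the space. *)
pose chi b := -1 * iter m (rotate n s) f b + sc 2^-1 (iter m (rotate n s) (sc 2 f)) b.
have [V [V0 xV]] : exists V : nat -> nat -> R, (forall i j, 0 < V i j) /\
    forall g, trap_space r s (num_at x) g -> rect_space r s V g.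
  exists (num_at (zeta LM x)); split=> [|g]; [exact: num_at_gt0|exact: trap_space_zeta].
have [A [A1 A2 A3 A4]] : rect_space r s V chi.
  by apply: xV; apply: trap_space_lin => //; apply: inv.
have [B [B1 B2 B3 B4]] := xV f xf.
have mn : (m <= n)%N by rewrite /n; lia.
have chiE b : (b.+1 < n)%N -> chi b = if b + m == n.-1 then f n.-1 else 0.
  move=> bn; have bn' : (b < n)%N by lia.
  rewrite /chi {1}/sc ltn_eqF// !iter_rotate// /sc.
  case: ltnP => [bm|bm].
    have [->|bmn] := eqVneq (b + m)%N n.-1; first by rewrite nE eqxx; ring.
    by rewrite ifF; [ring|apply/negP => /eqP; lia].
  rewrite [(_ + _ == _)%N]gtn_eqF; last by lia.
  by rewrite ifF; [ring|apply/negP => /eqP; lia].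
(* As [m <= r], the index [n - 1 - m] is at least [s - 1]. So [chi] vanishes on the left boundary
   below row [s], and the flow lives on the top row alone, where it is zero nowhere or
   everywhere. *)
have A0 : forall i j, (i <= r)%N -> (j <= s.-1)%N -> A i j = 0.
  apply: (rect_flow_eq0 A1 A2); first by lia.
  case=> [//|j] js; have js' : (j < s)%N by lia.
  have := A3 j js'; rewrite chiE ?ifF; try by rewrite /n; lia.
  by move/esym/eqP; rewrite mulf_eq0 signr_eq0 /= => /eqP.
have AS i : (i < r)%N -> chi (i.+1 + s.-1)%N = V i.+1 s * chi (i + s.-1)%N.
  move=> ir; rewrite !A4; try lia.
  have := A1 i s.-1 ir; rewrite prednK// => ->; last by lia.
  by rewrite [A i.+1 _]A0 ?addr0//; lia.
have [mr'|mr'] : (m = r) \/ (m < r)%N by lia.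
  have r0 : (0 < r)%N by lia.
  have chi_s : chi (0 + s.-1)%N = f n.-1.
    by rewrite chiE ?ifT//; rewrite /n; lia.
  have := AS 0%N r0; rewrite chi_s add1n prednK// => chi_s1.
  (* For [r = s = 1] the index 1 is the last one, and signs decide: [chi 1] is [- f 0 / 2], but the
     recurrence makes it positive. Otherwise index [s] lies outside the support. *)
  have [r1|r1] : (r = 1)%N \/ (1 < r)%N by lia.
    have s1 : s = 1%N by lia.
    have n2 : n = 2%N by rewrite /n; lia.
    have fE : f 1%N = V 1%N s * f 0%N.
      have := B4 1%N r0; have := B1 0%N 0%N r0 s_gt0; have := B4 0%N (leq0n _).
      by rewrite B2 addr0 s1 !addn0 => <- <- <-.
    move: chi_s1 f0; rewrite /chi /sc mr' r1 n2 /= /rotate s1 /= => E f0.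
    rewrite s1 in fE; rewrite add0n in f0; have := mulr_gt0 (V0 1%N 1%N) f0.
    have : 0 < f 0%N by rewrite -(pmulr_rgt0 _ (V0 1%N 1%N)) -fE.
    by rewrite -E expr0 !mul1r; lra.
  have : chi s = 0 by rewrite chiE ?ifF//; rewrite /n; lia.
  by rewrite chi_s1 => /eqP; rewrite mulf_eq0 !gt_eqF.
(* For [m < r] the top row starts with the value 0, which spreads to the index [n - 1 - m], where
   [chi] equals [f n.-1]. *)
have chi0 i : (i <= r)%N -> chi (i + s.-1)%N = 0.
  elim: i => [|i IH] ir; first by rewrite chiE ?ifF//; rewrite /n; lia.
  by rewrite AS ?IH ?mulr0//; lia.
have := chi0 (r - m)%N (leq_subr _ _); rewrite chiE ?ifT; try by rewrite /n; lia.
by move=> f00; rewrite f00 ltxx in f0.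
Qed.

Lemma rhoT_has_order : has_order rhoT (r + s)%N.
Proof.
split; [by lia|exact: rhoT_periodic|move=> m mn idm].
have [mr|mr] := leqP m r; first by apply: (@rhoT_iter_neq_id m) => //; lia.
(* The complementary iterate is then the identity as well, and [r + s - m < s <= r]. *)
apply: (@rhoT_iter_neq_id (r + s - m)); first by lia.
by move=> x; rewrite -{1}(idm x) -iterD subnK ?rhoT_periodic//; lia.
Qed.

End Equivariance.

Theorem corollary5p3 (R : realType) (r s : nat)
    (s_gt0 : (0 < s)%N) (le_sr : (s <= r)%N)
    (LT : linext (trapezoid r s)) (LR : linext (rectangle r s))
    (LM : forall k : nat, linext (Mposet r s k)) :
  [/\ zeta (R := R) LM \o antichain_rowmotion LT
        =1 antichain_rowmotion LR \o zeta LM,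
      has_order (@antichain_rowmotion R _ (trapezoid r s) LT) (r + s)%N &
      has_order (@rowmotion R _ (trapezoid r s) LT) (r + s)%N].
Proof.
have oT : has_order (@antichain_rowmotion R _ (trapezoid r s) LT) (r + s)%N.
  exact: (rhoT_has_order R s_gt0 le_sr LT LM).
split=> //; first by move=> x; apply: zeta_equivariant.
exact: has_order_rowmotion.
Qed.
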